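(* Let $R$ be a commutative unitary ring, $E$ the free $R$-module generated by $e_1,\dots,e_n$, $f\in E^\vee=\operatorname{Hom}_R(E,R)$, and let $K^*$ be the Koszul complex of the sequence $f_1=f(e_1),\dots,f_n=f(e_n)$, that is, $K^{-i}=\bigwedge^iE$ with differential the contraction operator $\boldsymbol{i}_f$. Then the contraction map $$\boldsymbol{i}\colon{\bigwedge}^*E^\vee\to\operatorname{Hom}^*_R(K^*,K^* ),\qquad\psi\mapsto\boldsymbol{i}_\psi,$$ is a morphism of differential graded algebras. If $K^*$ is exact, then $\boldsymbol{i}$ is surjective in cohomology and therefore the DG-Lie algebra $\operatorname{Hom}^*_R(K^*,K^* )$ is numerically homotopy abelian.
   Context: **Contractions.** The internal product $\lrcorner\colon\bigwedge^*E^\vee\times\bigwedge^*E\to\bigwedge^*E$ is the $R$-bilinear map defined recursively by $g\lrcorner(v_1\wedge\cdots\wedge v_b)=\sum_{i=1}^b(-1)^{i-1}g(v_i)\,v_1\wedge\cdots\wedge\widehat{v_i}\wedge\cdots\wedge v_b$ for $g\in E^\vee$, and $(g_1\wedge\cdots\wedge g_a)\lrcorner\omega=(g_1\wedge\cdots\wedge g_{a-1})\lrcorner(g_a\lrcorner\omega)$. For $\psi\in\bigwedge^*E^\vee$, $\boldsymbol{i}_\psi(\omega)=\psi\lrcorner\omega$. $\bigwedge^*E^\vee$ is regarded as a differential graded commutative algebra with trivial differential and $\bigwedge^iE^\vee$ in degree $i$. The Koszul complex is $K^*\colon 0\to K^{-n}\xrightarrow{\boldsymbol{i}_f}K^{1-n}\to\cdots\to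 K^{-1}\xrightarrow{\boldsymbol{i}_f}K^0=R$. ''$K^*$ is exact'' means $H^j(K^* )=0$ for every $j\neq0$ (e.g. when $f_1,\dots,f_n$ is a regular sequence). $\operatorname{Hom}^*_R(K^*,K^* )$ is the differential graded algebra (under composition) of graded $R$-linear endomorphisms, with differential $[\boldsymbol{i}_f,-]$; it is a DG-Lie algebra with the graded commutator. **DG-Lie algebras over $R$.** A DG-Lie algebra over $R$ is a cochain complex $(L,d)$ of $R$-modules with an $R$-bilinear bracket such that, for homogeneous elements: $[L^i,L^j]\subset L^{i+j}$; $[a,b]+(-1)^{\bar a\bar b}[b,a]=0$; $[a,a]=0$ for $a$ of even degree; $d[a,b]=[da,b]+(-1)^{\bar a}[a,db]$; $[a,[b,c]]=[[a,b],c]+(-1)^{\bar a\bar b}[b,[a,c]]$; $[b,[b,b]]=0$ for $b$ of odd degree. It is abelian if the bracket is zero. A DG-Lie algebra $L$ over $R$ is numerically homotopy abelian if there is a finite zigzag of morphisms of DG-Lie algebras over $R$, $L\xleftarrow{f_1}L_1\xrightarrow{g_1}L_2\xleftarrow{f_3}L_3\xrightarrow{g_3}\cdots\xleftarrow{f_m}L_m\xrightarrow{g_m}M$, with $M$ abelian, every $f_i$ surjective in cohomology and every $g_i$ injective in cohomology. *)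

(* Defs.v *)
From HB Require Import structures.
From mathcomp Require Import all_boot all_order all_algebra.
From mathcomp Require Import boolp.

Set Implicit Arguments.
Unset Strict Implicit.
Unset Printing Implicit Defensive.

Import GRing.Theory.
Local Open Scope ring_scope.
Local Open Scope quotient_scope.

Section LinearMaps.
Variables (R : comPzRingType) (U V : lmodType R).
Implicit Types f g : {linear U -> V}.

Lemma linear_map_eq f g : f =1 g -> f = g.
Proof.
case: f g => [f cf] [g cg] /= /funext efg; subst g.
by congr GRing.Linear.Pack; case: cf cg => [[?] [?]] [[?] [?]];
  congr GRing.Linear.Class; congr (_ _); apply: Prop_irrelevance.
Qed.

HB.instance Definition _ := gen_eqMixin {linear U -> V}.
HB.instance Definition _ := gen_choiceMixin {linear U -> V}.

Definition lin_add f g : {linear U -> V} := f \+ g.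
Definition lin_opp f : {linear U -> V} := \- f.
Definition lin_zero : {linear U -> V} := \0.
Definition lin_scale (a : R) f : {linear U -> V} := a \*: f.

Lemma lin_addA : associative lin_add.
Proof. by move=> f g h; apply: linear_map_eq => x /=; rewrite addrA. Qed.
Lemma lin_addC : commutative lin_add.
Proof. by move=> f g; apply: linear_map_eq => x /=; rewrite addrC. Qed.
Lemma lin_add0 : left_id lin_zero lin_add.
Proof. by move=> f; apply: linear_map_eq => x /=; rewrite add0r. Qed.
Lemma lin_addN : left_inverse lin_zero lin_opp lin_add.
Proof. by move=> f; apply: linear_map_eq => x /=; rewrite addNr. Qed.

HB.instance Definition _ := GRing.isZmodule.Build {linear U -> V}
  lin_addA lin_addC lin_add0 lin_addN.

Lemma lin_scaleA a b f : lin_scale a (lin_scale b f) = lin_scale (a * b) f.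
Proof. by apply: linear_map_eq => x /=; rewrite scalerA. Qed.
Lemma lin_scale1 : left_id 1 lin_scale.
Proof. by move=> f; apply: linear_map_eq => x /=; rewrite scale1r. Qed.
Lemma lin_scaleDr : right_distributive lin_scale +%R.
Proof. by move=> a f g; apply: linear_map_eq => x /=; rewrite scalerDr. Qed.
Lemma lin_scaleDl f : {morph lin_scale^~ f : a b / a + b}.
Proof. by move=> a b; apply: linear_map_eq => x /=; rewrite scalerDl. Qed.

HB.instance Definition _ := GRing.Zmodule_isLmodule.Build R {linear U -> V}
  lin_scaleA lin_scale1 lin_scaleDr lin_scaleDl.

Lemma lin_addE f g x : (f + g) x = f x + g x. Proof. by []. Qed.
Lemma lin_scaleE a f x : (a *: f) x = a *: f x. Proof. by []. Qed.

End LinearMaps.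


(* The exterior algebra of an arbitrary module M, as a quotient of the formal
   linear combinations of words v_1 ... v_b in M (the word standing for
   v_1 /\ ... /\ v_b): two combinations are identified iff no map on words that
   is multilinear and vanishes on words with two equal consecutive letters
   separates them, i.e. modulo the ideal of the tensor algebra generated by the
   v (x) v. *)
Section ExteriorAlgebra.
Variables (R : comPzRingType) (M : lmodType R).
Implicit Types (N : lmodType R) (s t w : seq M).

Definition alternating N (al : seq M -> N) : Prop :=
  (forall s t, linear (fun v => al (s ++ v :: t))) /\
  (forall s t v, al (s ++ v :: v :: t) = 0).

Definition fsum := seq (R * seq M).

Definition fsum_eval N (al : seq M -> N) (x : fsum) : N :=
  \sum_(c <- x) c.1 *: al c.2.

Lemma linear_fsum (N P : lmodType R) (p : N -> P) (al : seq M -> N) x :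
  linear p -> p (fsum_eval al x) = fsum_eval (p \o al) x.
Proof.
move=> hp; pose L : {linear N -> P} :=
  HB.pack p (GRing.isLinear.Build _ _ _ _ _ hp).
have pE y : p y = L y by [].
rewrite /fsum_eval pE linear_sum; apply: eq_bigr => c _.
by rewrite linearZ.
Qed.

Definition ext_rel (x y : fsum) : bool :=
  `[< forall N (al : seq M -> N), alternating al ->
        fsum_eval al x = fsum_eval al y >].

Lemma ext_rel_refl : reflexive ext_rel.
Proof. by move=> x; apply/asboolP. Qed.
Lemma ext_rel_sym : symmetric ext_rel.
Proof. by move=> x y; apply/asboolP/asboolP => h N al /h. Qed.
Lemma ext_rel_trans : transitive ext_rel.
Proof.
move=> y x z /asboolP hxy /asboolP hyz; apply/asboolP => N al hal.
by rewrite hxy // hyz.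
Qed.

Definition ext_equiv := EquivRel ext_rel ext_rel_refl ext_rel_sym ext_rel_trans.

Definition ext := {eq_quot ext_equiv}.
HB.instance Definition _ := Choice.on ext.
HB.instance Definition _ := EqQuotient.on ext.

Definition ext_lift N (al : seq M -> N) (x : ext) : N := fsum_eval al (repr x).

Lemma ext_lift_pi N (al : seq M -> N) (x : fsum) :
  alternating al -> ext_lift al (\pi x) = fsum_eval al x.
Proof.
move=> hal; rewrite /ext_lift.
have /eqmodP/asboolP : repr (\pi_ext x) = x %[mod ext] by rewrite reprK.
exact.
Qed.

Lemma ext_eq (x y : ext) :
  (forall N (al : seq M -> N), alternating al -> ext_lift al x = ext_lift al y) ->
  x = y.
Proof.
move=> h; rewrite -[x]reprK -[y]reprK; apply/eqmodP/asboolP => N al hal.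
exact: h.
Qed.

Definition ext_zero : ext := \pi_ext ([::] : fsum).
Definition ext_add (x y : ext) : ext := \pi_ext (repr x ++ repr y : fsum).
Definition ext_scale (a : R) (x : ext) : ext :=
  \pi_ext ([seq (a * c.1, c.2) | c <- repr x] : fsum).
Definition ext_opp (x : ext) : ext := ext_scale (-1) x.

Section LiftMorph.
Variables (N : lmodType R) (al : seq M -> N) (hal : alternating al).

Lemma ext_lift_zero : ext_lift al ext_zero = 0.
Proof. by rewrite ext_lift_pi // /fsum_eval big_nil. Qed.
Lemma ext_lift_add x y : ext_lift al (ext_add x y) = ext_lift al x + ext_lift al y.
Proof. by rewrite ext_lift_pi // /fsum_eval big_cat. Qed.
Lemma ext_lift_scale a x : ext_lift al (ext_scale a x) = a *: ext_lift al x.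
Proof.
rewrite ext_lift_pi // /fsum_eval big_map scaler_sumr.
by apply: eq_bigr => c _; rewrite scalerA.
Qed.
Lemma ext_lift_opp x : ext_lift al (ext_opp x) = - ext_lift al x.
Proof. by rewrite ext_lift_scale scaleN1r. Qed.
End LiftMorph.

Lemma ext_addA : associative ext_add.
Proof. by move=> x y z; apply: ext_eq => N al h; rewrite !ext_lift_add // addrA. Qed.
Lemma ext_addC : commutative ext_add.
Proof. by move=> x y; apply: ext_eq => N al h; rewrite !ext_lift_add // addrC. Qed.
Lemma ext_add0 : left_id ext_zero ext_add.
Proof.
by move=> x; apply: ext_eq => N al h; rewrite ext_lift_add // ext_lift_zero // add0r.
Qed.
Lemma ext_addN : left_inverse ext_zero ext_opp ext_add.
Proof.
move=> x; apply: ext_eq => N al h.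
by rewrite ext_lift_add // ext_lift_opp // ext_lift_zero // addNr.
Qed.

HB.instance Definition _ := GRing.isZmodule.Build ext
  ext_addA ext_addC ext_add0 ext_addN.

Lemma ext_scaleA a b x : ext_scale a (ext_scale b x) = ext_scale (a * b) x.
Proof. by apply: ext_eq => N al h; rewrite !ext_lift_scale // scalerA. Qed.
Lemma ext_scale1 : left_id 1 ext_scale.
Proof. by move=> x; apply: ext_eq => N al h; rewrite ext_lift_scale // scale1r. Qed.
Lemma ext_scaleDr : right_distributive ext_scale +%R.
Proof.
move=> a x y; apply: ext_eq => N al h.
by rewrite ext_lift_scale // !ext_lift_add // !ext_lift_scale // scalerDr.
Qed.
Lemma ext_scaleDl x : {morph ext_scale^~ x : a b / a + b}.
Proof.
move=> a b; apply: ext_eq => N al h.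
by rewrite ext_lift_add // !ext_lift_scale // scalerDl.
Qed.

HB.instance Definition _ := GRing.Zmodule_isLmodule.Build R ext
  ext_scaleA ext_scale1 ext_scaleDr ext_scaleDl.

Lemma ext_liftP N (al : seq M -> N) : alternating al -> linear (ext_lift al).
Proof.
move=> hal a x y.
by rewrite [LHS](ext_lift_add hal) [in LHS](ext_lift_scale hal).
Qed.

Definition wedge (s : seq M) : ext := \pi_ext ([:: (1, s)] : fsum).

Lemma ext_lift_wedge N (al : seq M -> N) s :
  alternating al -> ext_lift al (wedge s) = al s.
Proof. by move=> h; rewrite ext_lift_pi // /fsum_eval big_seq1 scale1r. Qed.

Lemma pi_fsum (x : fsum) : \pi_ext x = fsum_eval wedge x.
Proof.
apply: ext_eq => N al h; rewrite ext_lift_pi //.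
rewrite (linear_fsum _ _ (ext_liftP h)) /fsum_eval; apply: eq_bigr => c _ /=.
by rewrite ext_lift_wedge.
Qed.

Lemma ext_wedgeE (x : ext) : x = fsum_eval wedge (repr x).
Proof. by rewrite -pi_fsum reprK. Qed.

Lemma wedge_alternating : alternating wedge.
Proof.
split=> [s t a u v|s t v]; apply: ext_eq => N al h.
  rewrite ext_lift_wedge // (ext_liftP h) !ext_lift_wedge //.
  exact: (h.1 s t a u v).
by rewrite ext_lift_wedge // ext_lift_zero // h.2.
Qed.

Lemma ext_linear_eq N (p q : ext -> N) :
  linear p -> linear q -> (forall s, p (wedge s) = q (wedge s)) -> p =1 q.
Proof.
move=> hp hq h x; rewrite (ext_wedgeE x) !linear_fsum // /fsum_eval.
by apply: eq_bigr => c _ /=; rewrite h.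
Qed.

Definition ext_mul (x y : ext) : ext :=
  ext_lift (fun s => ext_lift (fun t => wedge (s ++ t)) y) x.

Lemma wedge_catl_alt s : alternating (fun t => wedge (s ++ t)).
Proof.
split=> [s1 t a u v|s1 t v]; first by rewrite !catA; apply: wedge_alternating.1.
by rewrite catA wedge_alternating.2.
Qed.

Lemma wedge_catr_alt t : alternating (fun s => wedge (s ++ t)).
Proof.
split=> [s1 t1 a u v|s1 t1 v]; rewrite -!catA /=.
  exact: wedge_alternating.1.
exact: wedge_alternating.2.
Qed.

Lemma fsum_eval_alt N (al : seq M -> seq M -> N) (x : fsum) :
  (forall t, alternating (al^~ t)) ->
  alternating (fun s => fsum_eval (al s) x).
Proof.
move=> h; split=> [s t a u v|s t v]; rewrite /fsum_eval.
  rewrite scaler_sumr -big_split; apply: eq_bigr => c _ /=.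
  by rewrite (h c.2).1 scalerDr !scalerA mulrC.
by rewrite big1 // => c _; rewrite (h c.2).2 scaler0.
Qed.

Lemma ext_mul_alt y : alternating (fun s => ext_lift (fun t => wedge (s ++ t)) y).
Proof. exact: (fsum_eval_alt (al := fun s t => wedge (s ++ t)) _ wedge_catr_alt). Qed.

Lemma ext_mulDl y : linear (ext_mul^~ y).
Proof. exact: ext_liftP (ext_mul_alt y). Qed.

Lemma ext_mulDr x : linear (ext_mul x).
Proof.
move=> a y z; rewrite /ext_mul {1 3 5}/ext_lift /fsum_eval scaler_sumr -big_split.
apply: eq_bigr => c _ /=; rewrite (ext_liftP (wedge_catl_alt _)) scalerDr.
by rewrite !scalerA mulrC.
Qed.

Lemma ext_mul_wedge s t : ext_mul (wedge s) (wedge t) = wedge (s ++ t).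
Proof.
rewrite /ext_mul (ext_lift_wedge _ (ext_mul_alt _)).
by rewrite (ext_lift_wedge _ (wedge_catl_alt _)).
Qed.

Lemma linear_comp_ext (N P : lmodType R) (p : N -> P) (q : ext -> N) :
  linear p -> linear q -> linear (p \o q).
Proof. by move=> hp hq a x y /=; rewrite hq hp. Qed.

Lemma ext_mulA : associative ext_mul.
Proof.
move=> x y z.
apply: (ext_linear_eq (p := ext_mul^~ (ext_mul y z))
                      (q := (ext_mul^~ z) \o (ext_mul^~ y))) x.
- exact: ext_mulDl.
- exact: linear_comp_ext (ext_mulDl z) (ext_mulDl y).
move=> s /=.
apply: (ext_linear_eq (p := (ext_mul (wedge s)) \o (ext_mul^~ z))
                      (q := (ext_mul^~ z) \o (ext_mul (wedge s)))) y.
- exact: linear_comp_ext (ext_mulDr _) (ext_mulDl z).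
- exact: linear_comp_ext (ext_mulDl z) (ext_mulDr _).
move=> t /=.
apply: (ext_linear_eq (p := (ext_mul (wedge s)) \o (ext_mul (wedge t)))
                      (q := ext_mul (ext_mul (wedge s) (wedge t)))) z.
- exact: linear_comp_ext (ext_mulDr _) (ext_mulDr _).
- exact: ext_mulDr.
by move=> w /=; rewrite !ext_mul_wedge catA.
Qed.

Lemma ext_mul1l : left_id (wedge [::]) ext_mul.
Proof.
apply: (@ext_linear_eq ext (ext_mul (wedge [::])) id) => //.
  exact: ext_mulDr.
by move=> s; rewrite ext_mul_wedge.
Qed.
Lemma ext_mul1r : right_id (wedge [::]) ext_mul.
Proof.
apply: (@ext_linear_eq ext (ext_mul^~ (wedge [::])) id) => //.
  exact: ext_mulDl.
by move=> s; rewrite ext_mul_wedge cats0.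
Qed.

Lemma ext_mul_distl : left_distributive ext_mul +%R.
Proof. by move=> x y z; have := ext_mulDl z 1 x y; rewrite !scale1r. Qed.
Lemma ext_mul_distr : right_distributive ext_mul +%R.
Proof. by move=> z x y; have := ext_mulDr z 1 x y; rewrite !scale1r. Qed.

HB.instance Definition _ := GRing.Zmodule_isPzRing.Build ext
  ext_mulA ext_mul1l ext_mul1r ext_mul_distl ext_mul_distr.

Lemma ext_scaleAl (a : R) (x y : ext) : a *: (x * y) = a *: x * y.
Proof.
have : (a *: x + 0) * y = a *: (x * y) + 0 * y := ext_mulDl y a x 0.
by rewrite mul0r !addr0.
Qed.
Lemma ext_scaleAr (a : R) (x y : ext) : a *: (x * y) = x * (a *: y).
Proof.
have : x * (a *: y + 0) = a *: (x * y) + x * 0 := ext_mulDr x a y 0.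
by rewrite mulr0 !addr0.
Qed.

Lemma wedgeM s t : wedge (s ++ t) = wedge s * wedge t.
Proof. by rewrite -ext_mul_wedge. Qed.
Lemma wedge0 : wedge [::] = 1.
Proof. by []. Qed.
Lemma wedge_cons v s : wedge (v :: s) = wedge [:: v] * wedge s.
Proof. by rewrite -wedgeM. Qed.
Lemma wedge_sqr v : wedge [:: v] * wedge [:: v] = 0.
Proof. by rewrite -wedgeM (wedge_alternating.2 [::] [::]). Qed.
Lemma wedge1_linear : linear (fun v => wedge [:: v]).
Proof. exact: (wedge_alternating.1 [::] [::]). Qed.

(* the degree k part; it is zero when k < 0, as no word has negative length *)
Definition homog (k : int) : {pred ext} :=
  fun x => `[< exists2 y : fsum, all (fun c => (size c.2)%:Z == k) y & x = \pi y >].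

Lemma homogP k x :
  reflect (exists2 y : fsum, all (fun c => (size c.2)%:Z == k) y &
             x = fsum_eval wedge y) (x \in homog k).
Proof.
by apply: (iffP (asboolP _)) => -[y hy ->]; exists y; rewrite // pi_fsum.
Qed.

Lemma homog_submod k : submod_closed (homog k).
Proof.
split; first by apply/homogP; exists [::]; rewrite // /fsum_eval big_nil.
move=> a _ _ /homogP[y hy ->] /homogP[z hz ->]; apply/homogP.
exists ([seq (a * c.1, c.2) | c <- y] ++ z).
  by rewrite all_cat all_map hz andbT.
rewrite /fsum_eval big_cat big_map scaler_sumr; congr (_ + _).
by apply: eq_bigr => c _; rewrite scalerA.
Qed.

Lemma homog_wedge s : wedge s \in homog (size s).
Proof. by apply/asboolP; exists [:: (1, s)]; rewrite //= eqxx. Qed.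

Lemma homog_mul i j x y :
  x \in homog i -> y \in homog j -> x * y \in homog (i + j).
Proof.
move=> /homogP[a ha ->] /homogP[b hb ->]; apply/homogP.
exists [seq (c.1 * d.1, c.2 ++ d.2) | c <- a, d <- b].
  apply/allP => _ /allpairsP[[c d] /= [/(allP ha)/eqP hc /(allP hb)/eqP hd ->]].
  by rewrite /= size_cat PoszD hc hd.
rewrite -[_ * _]/(ext_mul _ _) (linear_fsum _ _ (ext_mulDl _)) /fsum_eval big_allpairs_dep.
apply: eq_bigr => c _ /=; rewrite (linear_fsum _ _ (ext_mulDr _)) scaler_sumr.
by apply: eq_bigr => d _ /=; rewrite ext_mul_wedge scalerA.
Qed.

End ExteriorAlgebra.

HB.instance Definition _ (R : comPzRingType) (M : lmodType R) k :=
  GRing.isSubmodClosed.Build R (ext M) (@homog R M k) (@homog_submod R M k).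

Record extpow (R : comPzRingType) (M : lmodType R) (k : int) : Type :=
  ExtPow { extval :> ext M; extvalP : extval \in homog k }.

Section ExtPow.
Variables (R : comPzRingType) (M : lmodType R) (k : int).
HB.instance Definition _ := [isSub of extpow M k for @extval R M k].
HB.instance Definition _ := [Choice of extpow M k by <:].
HB.instance Definition _ := [SubChoice_isSubLmodule of extpow M k by <:].
End ExtPow.

Section Contraction.
Variables (R : comPzRingType) (E : lmodType R).
Local Notation dual := {linear E -> R^o}.
Implicit Types (g : dual) (s t : seq E).

(* sum over i of (-1)^(i-1) g(v_i) v_1 /\ .. /\ v_b with v_i omitted; the sign
   differs because positions are counted from 0 *)
Definition contr_word g s : ext E :=
  \sum_(i < size s)
    ((-1) ^+ i * g (nth 0 s i) : R) *: wedge (take i s ++ drop i.+1 s).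

Definition contr1 g : ext E -> ext E := ext_lift (contr_word g).

(* the last form g_a of the word is contracted first *)
Definition contr (psi : ext dual) (w : ext E) : ext E :=
  ext_lift (fun gs : seq dual => foldr contr1 w gs) psi.

Lemma contr_word_cons g v s :
  contr_word g (v :: s) =
  (g v : R) *: wedge s - wedge [:: v] * contr_word g s.
Proof.
rewrite /contr_word /= big_ord_recl /= expr0 mul1r drop0; congr (_ + _).
rewrite mulr_sumr -sumrN; apply: eq_bigr => i _ /=.
rewrite -ext_scaleAr wedge_cons -scaleNr; congr (_ *: _).
by rewrite exprS mulN1r mulNr.
Qed.

Lemma contr_word_cat g s t :
  contr_word g (s ++ t) =
  contr_word g s * wedge t + (-1) ^+ size s *: (wedge s * contr_word g t).
Proof.
elim: s => [|v s IH] /=.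
  by rewrite {2}/contr_word big_ord0 mul0r add0r scale1r wedge0 mul1r.
rewrite !contr_word_cons IH wedgeM mulrBl mulrDr opprD addrA -ext_scaleAl mulrA.
congr (_ + _).
by rewrite -ext_scaleAr mulrA -wedge_cons exprS mulN1r scaleNr.
Qed.

Lemma contr_word_alternating g : alternating (contr_word g).
Proof.
split=> [s t a u v|s t v].
  rewrite !contr_word_cat !contr_word_cons !(wedge_cons _ t) wedge1_linear linearP.
  have -> (b c : R) (x y z w : ext E) : (a * b + c) *: z - (a *: x + y) * w =
      a *: (b *: z - x * w) + (c *: z - y * w).
    by rewrite scalerDl mulrDl opprD addrACA scalerBr scalerA ext_scaleAl.
  rewrite mulrDl !mulrDr -!(ext_scaleAl a) -!(ext_scaleAr a).
  rewrite [in LHS]scalerDr [in RHS]scalerDr addrACA !scalerA.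
  by rewrite ![wedge s * (_ - _)]mulrDr [_ * a]mulrC.
rewrite contr_word_cat !contr_word_cons (wedge_cons v (v :: t)) (wedge_cons v t).
rewrite [wedge [:: v] * (_ - _)]mulrBr -ext_scaleAr subKr.
by rewrite ![wedge [:: v] * (wedge [:: v] * _)]mulrA wedge_sqr !(mul0r, mulr0) scaler0 addr0.
Qed.

Lemma contr1_linear g : linear (contr1 g).
Proof. exact: ext_liftP (contr_word_alternating g). Qed.

Lemma contr1_wedge g s : contr1 g (wedge s) = contr_word g s.
Proof. exact: ext_lift_wedge (contr_word_alternating g). Qed.

HB.instance Definition _ g :=
  GRing.isLinear.Build R (ext E) (ext E) *:%R (contr1 g) (contr1_linear g).

Lemma contr1_1 g : contr1 g 1 = 0.
Proof. by rewrite -wedge0 contr1_wedge /contr_word big_ord0. Qed.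

Lemma contr1_cons g v (x : ext E) :
  contr1 g (wedge [:: v] * x) = (g v : R) *: x - wedge [:: v] * contr1 g x.
Proof.
rewrite (ext_wedgeE x) [in LHS]/GRing.mul /=.
rewrite [in LHS](linear_fsum _ _ (ext_mulDr _)).
rewrite !(linear_fsum _ _ (contr1_linear _)) /fsum_eval scaler_sumr mulr_sumr -sumrB.
apply: eq_bigr => c _ /=; rewrite ext_mul_wedge cat1s !contr1_wedge.
by rewrite contr_word_cons scalerBr -ext_scaleAr !scalerA mulrC.
Qed.

Lemma contr1_contr1 g (x : ext E) : contr1 g (contr1 g x) = 0.
Proof.
apply: (ext_linear_eq (p := contr1 g \o contr1 g) (q := fun=> 0)) x.
- exact: linear_comp_ext (contr1_linear g) (contr1_linear g).
- by move=> a x y; rewrite scaler0 addr0.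
elim=> [|v s IH] /=; first by rewrite wedge0 contr1_1 linear0.
rewrite wedge_cons contr1_cons linearB linearZ /= contr1_cons [contr1 g (contr1 g _)]IH.
by rewrite mulr0 subr0 subrr.
Qed.

Lemma contr1_linear_form (x : ext E) : linear (fun g : dual => contr1 g x).
Proof.
move=> a g h; rewrite (ext_wedgeE x) !(linear_fsum _ _ (contr1_linear _)).
rewrite /fsum_eval scaler_sumr -big_split; apply: eq_bigr => c _ /=.
rewrite scalerA [a * _]mulrC -scalerA -scalerDr; congr (_ *: _).
rewrite !contr1_wedge /contr_word scaler_sumr -big_split; apply: eq_bigr => i _ /=.
rewrite scalerA -scalerDl; congr (_ *: _).
by rewrite mulrDr mulrCA.
Qed.

Lemma foldr_contr1_linear (gs : seq dual) : linear (fun w => foldr contr1 w gs).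
Proof.
by elim: gs => [|g gs IH] a x y //=; rewrite IH; apply: contr1_linear.
Qed.

Lemma foldr_contr1_alternating (w : ext E) :
  alternating (fun gs : seq dual => foldr contr1 w gs).
Proof.
split=> [gs hs a g h|gs hs g]; rewrite !foldr_cat /=.
  by rewrite contr1_linear_form; apply: foldr_contr1_linear.
rewrite contr1_contr1; elim: gs => //= k gs ->; exact: linear0.
Qed.

Lemma contr_linear_form (w : ext E) : linear (contr^~ w).
Proof. exact: ext_liftP (foldr_contr1_alternating w). Qed.

Lemma contr_wedge (gs : seq dual) (w : ext E) :
  contr (wedge gs) w = foldr contr1 w gs.
Proof. exact: ext_lift_wedge (foldr_contr1_alternating w). Qed.

Lemma contr_linear (psi : ext dual) : linear (contr psi).
Proof.
move=> a x y; rewrite /contr /ext_lift /fsum_eval scaler_sumr -big_split.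
apply: eq_bigr => c _ /=; rewrite foldr_contr1_linear scalerDr.
by rewrite !scalerA mulrC.
Qed.

Lemma homog_contr1 g (x : ext E) k : x \in homog k -> contr1 g x \in homog (k - 1).
Proof.
move=> /homogP[y hy ->]; rewrite (linear_fsum _ _ (contr1_linear g)) /fsum_eval.
rewrite big_seq; apply: rpred_sum => c /(allP hy)/eqP hc /=; apply: rpredZ.
rewrite contr1_wedge; apply: rpred_sum => i _; apply: rpredZ.
suff -> : k - 1 = size (take i c.2 ++ drop i.+1 c.2) by apply: homog_wedge.
rewrite -hc size_cat size_takel ?size_drop; last exact: ltnW.
case: i => i /=; case: (size c.2) => // m im.
by rewrite subSS subnKC // -addn1 PoszD addrK.
Qed.

End Contraction.


Section Sign.
Variable R : comPzRingType.

Definition zsign (i : int) : R := (-1) ^+ `|i|%N.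

Lemma odd_abszD (i j : int) : odd `|(i + j)%R|%N = odd `|i|%N (+) odd `|j|%N.
Proof.
have oddB (m n : nat) : odd `|(m%:Z - n%:Z)%R|%N = odd m (+) odd n.
  by case: (leqP m n) => [h|/ltnW h]; [rewrite distnC|];
    rewrite distnEl // oddB // addbC.
case: i => m; case: j => n; rewrite ?NegzE.
- by rewrite -PoszD absz_nat oddD.
- by rewrite oddB abszN.
- by rewrite addrC oddB abszN addbC.
- by rewrite -opprD abszN -PoszD !abszN !absz_nat oddD.
Qed.

Lemma zsignD i j : zsign (i + j) = zsign i * zsign j.
Proof.
rewrite /zsign -signr_odd odd_abszD -exprD -[RHS]signr_odd oddD.
by [].
Qed.

Lemma zsign_sqr i : zsign i * zsign i = 1.
Proof. by rewrite /zsign -exprD addnn -signr_odd odd_double. Qed.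

Lemma zsign1 : zsign 1 = -1. Proof. by []. Qed.
Lemma zsign0 : zsign 0 = 1. Proof. by []. Qed.

Lemma zsign_even i : ~~ odd `|i|%N -> zsign i = 1.
Proof. by rewrite /zsign -signr_odd => /negbTE ->. Qed.

End Sign.
Arguments zsign R i : clear implicits.

(* Families indexed by int are used throughout; an operation landing in degree k
   takes a proof of the equation defining k, so that no transport between C (i + j)
   and C k is ever needed. *)
Section Complexes.
Variable R : comPzRingType.

Record complex : Type := Complex {
  cx :> int -> lmodType R;
  cxd : forall i j, i + 1 = j -> {linear cx i -> cx j};
  cxdd : forall i j k (h : i + 1 = j) (h' : j + 1 = k) x, cxd h' (cxd h x) = 0
}.
Arguments cxd {c i j} h.

Definition cocycle (C : complex) i (x : C i) : Prop :=
  forall j (h : i + 1 = j), cxd h x = 0.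

Definition coboundary (C : complex) j (x : C j) : Prop :=
  exists i (h : i + 1 = j) (y : C i), x = cxd h y.

Definition cohomology_vanishes (C : complex) i : Prop :=
  forall x : C i, cocycle x -> coboundary x.

Record cx_hom (C D : complex) : Type := CxHom {
  chom :> forall i, {linear C i -> D i};
  chom_d : forall i j (h : i + 1 = j) x, chom j (cxd h x) = cxd h (chom i x)
}.

Definition surjective_in_cohomology (C D : complex) (phi : cx_hom C D) : Prop :=
  forall i (y : D i), cocycle y ->
    exists2 x : C i, cocycle x & coboundary (y - phi i x).

Definition injective_in_cohomology (C D : complex) (phi : cx_hom C D) : Prop :=
  forall i (x : C i), cocycle x -> coboundary (phi i x) -> coboundary x.

Record dga : Type := Dga {
  dga_cx :> complex;
  dga_mul : forall i j k, i + j = k -> dga_cx i -> dga_cx j -> dga_cx k;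
  dga_one : dga_cx 0;
  dga_linl : forall i j k (h : i + j = k) b, linear (fun a => dga_mul h a b);
  dga_linr : forall i j k (h : i + j = k) a, linear (dga_mul h a);
  dga_assoc : forall i j k ij jk n (h1 : i + j = ij) (h2 : j + k = jk)
      (h3 : ij + k = n) (h4 : i + jk = n) a b c,
    dga_mul h3 (dga_mul h1 a b) c = dga_mul h4 a (dga_mul h2 b c);
  dga_mul1l : forall i (h : 0 + i = i) a, dga_mul h dga_one a = a;
  dga_mul1r : forall i (h : i + 0 = i) a, dga_mul h a dga_one = a;
  dga_leibniz : forall i j k i' j' k' (h : i + j = k) (hk : k + 1 = k')
      (hi : i + 1 = i') (hj : j + 1 = j') (h1 : i' + j = k') (h2 : i + j' = k') a b,
    cxd hk (dga_mul h a b) =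
      dga_mul h1 (cxd hi a) b + zsign R i *: dga_mul h2 a (cxd hj b)
}.

Record dga_hom (A B : dga) : Type := DgaHom {
  dgah :> cx_hom A B;
  dgah_mul : forall i j k (h : i + j = k) a b,
    dgah k (dga_mul h a b) = dga_mul h (dgah i a) (dgah j b);
  dgah_one : dgah 0 (dga_one A) = dga_one B
}.

Record dglie : Type := Dglie {
  dgl_cx :> complex;
  dgl_br : forall i j k, i + j = k -> dgl_cx i -> dgl_cx j -> dgl_cx k;
  dgl_linl : forall i j k (h : i + j = k) b, linear (fun a => dgl_br h a b);
  dgl_linr : forall i j k (h : i + j = k) a, linear (dgl_br h a);
  dgl_anti : forall i j k (h : i + j = k) (h' : j + i = k) a b,
    dgl_br h a b + zsign R (i * j) *: dgl_br h' b a = 0;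
  dgl_even : forall i k (h : i + i = k) a, ~~ odd `|i|%N -> dgl_br h a a = 0;
  dgl_leibniz : forall i j k i' j' k' (h : i + j = k) (hk : k + 1 = k')
      (hi : i + 1 = i') (hj : j + 1 = j') (h1 : i' + j = k') (h2 : i + j' = k') a b,
    cxd hk (dgl_br h a b) =
      dgl_br h1 (cxd hi a) b + zsign R i *: dgl_br h2 a (cxd hj b);
  dgl_jacobi : forall i j k ij jk ik n (h1 : j + k = jk) (h2 : i + jk = n)
      (h3 : i + j = ij) (h4 : ij + k = n) (h5 : i + k = ik) (h6 : j + ik = n) a b c,
    dgl_br h2 a (dgl_br h1 b c) =
      dgl_br h4 (dgl_br h3 a b) c + zsign R (i * j) *: dgl_br h6 b (dgl_br h5 a c);
  dgl_odd : forall i k n (h : i + i = k) (h' : i + k = n) b, odd `|i|%N ->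
    dgl_br h' b (dgl_br h b b) = 0
}.

Definition dgl_abelian (L : dglie) : Prop :=
  forall i j k (h : i + j = k) (a : L i) (b : L j), dgl_br h a b = 0.

Record dgl_hom (L M : dglie) : Type := DglHom {
  dglh :> cx_hom L M;
  dglh_br : forall i j k (h : i + j = k) a b,
    dglh k (dgl_br h a b) = dgl_br h (dglh i a) (dglh j b)
}.

Inductive numerically_homotopy_abelian : dglie -> Prop :=
| Nha_last (L L1 M : dglie) (f : dgl_hom L1 L) (g : dgl_hom L1 M) :
    surjective_in_cohomology f -> injective_in_cohomology g -> dgl_abelian M ->
    numerically_homotopy_abelian L
| Nha_step (L L1 L2 : dglie) (f : dgl_hom L1 L) (g : dgl_hom L1 L2) :
    surjective_in_cohomology f -> injective_in_cohomology g ->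
    numerically_homotopy_abelian L2 -> numerically_homotopy_abelian L.

End Complexes.
Arguments cxd {R c i j} h.

Section CommutatorLie.
Variables (R : comPzRingType) (A : dga R).

Definition addC_eq (i j k : int) (h : i + j = k) : j + i = k :=
  etrans (addrC j i) h.

Definition dga_br i j k (h : i + j = k) (a : A i) (b : A j) : A k :=
  dga_mul h a b - zsign R (i * j) *: dga_mul (addC_eq h) b a.

Lemma dga_mulE i j k (h h' : i + j = k) (a : A i) (b : A j) :
  dga_mul h a b = dga_mul h' a b.
Proof. by rewrite (eq_irrelevance h h'). Qed.

Lemma dga_mulB i j k (h : i + j = k) (a : A i) (b c : A j) :
  dga_mul h a (b - c) = dga_mul h a b - dga_mul h a c.
Proof. by rewrite addrC -scaleN1r dga_linr scaleN1r addrC. Qed.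
Lemma dga_Bmul i j k (h : i + j = k) (a c : A i) (b : A j) :
  dga_mul h (a - c) b = dga_mul h a b - dga_mul h c b.
Proof. by rewrite addrC -scaleN1r (dga_linl h b) scaleN1r addrC. Qed.
Lemma dga_mul0 i j k (h : i + j = k) (a : A i) : dga_mul h a (0 : A j) = 0.
Proof. by rewrite -[0 in LHS](subrr 0) dga_mulB subrr. Qed.
Lemma dga_0mul i j k (h : i + j = k) (b : A j) : dga_mul h (0 : A i) b = 0.
Proof. by rewrite -[0 in LHS](subrr 0) dga_Bmul subrr. Qed.
Lemma dga_mulZ i j k (h : i + j = k) s (a : A i) (b : A j) :
  dga_mul h a (s *: b) = s *: dga_mul h a b.
Proof. by rewrite -[s *: b]addr0 dga_linr dga_mul0 addr0. Qed.
Lemma dga_Zmul i j k (h : i + j = k) s (a : A i) (b : A j) :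
  dga_mul h (s *: a) b = s *: dga_mul h a b.
Proof. by rewrite -[s *: a]addr0 (dga_linl h b) dga_0mul addr0. Qed.

Lemma dga_br_linl i j k (h : i + j = k) b : linear (fun a => dga_br h a b).
Proof.
move=> s x y; rewrite /dga_br (dga_linl h b) dga_linr scalerDr opprD addrACA.
by rewrite scalerA mulrC -scalerA -scalerBr.
Qed.

Lemma dga_br_linr i j k (h : i + j = k) a : linear (dga_br h a).
Proof.
move=> s x y; rewrite /dga_br (dga_linl _ a) dga_linr scalerDr opprD addrACA.
by rewrite scalerA mulrC -scalerA -scalerBr.
Qed.

Lemma dga_br_anti i j k (h : i + j = k) (h' : j + i = k) a b :
  dga_br h a b + zsign R (i * j) *: dga_br h' b a = 0.
Proof.
rewrite /dga_br [j * i]mulrC scalerBr scalerA zsign_sqr scale1r.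
rewrite (dga_mulE (addC_eq h) h') (dga_mulE (addC_eq h') h).
by rewrite addrA subrK subrr.
Qed.

Lemma dga_br_even i k (h : i + i = k) a : ~~ odd `|i|%N -> dga_br h a a = 0.
Proof.
move=> ev; rewrite /dga_br (dga_mulE (addC_eq h) h).
by rewrite zsign_even ?scale1r ?subrr // abszM oddM negb_and ev.
Qed.

Lemma dga_br_leibniz i j k i' j' k' (h : i + j = k) (hk : k + 1 = k')
    (hi : i + 1 = i') (hj : j + 1 = j') (h1 : i' + j = k') (h2 : i + j' = k') a b :
  cxd hk (dga_br h a b) =
    dga_br h1 (cxd hi a) b + zsign R i *: dga_br h2 a (cxd hj b).
Proof.
rewrite /dga_br linearB linearZ /=.
rewrite (dga_leibniz h hk hi hj h1 h2).
rewrite (dga_leibniz (addC_eq h) hk hj hi (addC_eq h2) (addC_eq h1)).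
have -> : zsign R (i' * j) = zsign R (i * j) * zsign R j.
  by rewrite -hi mulrDl mul1r zsignD.
have -> : zsign R (i * j') = zsign R i * zsign R (i * j).
  by rewrite -hj mulrDr mulr1 zsignD mulrC.
rewrite scalerDr scalerBr !scalerA mulrA zsign_sqr mul1r opprD.
by rewrite [X in _ + X = _]addrC addrACA.
Qed.

Lemma dga_br_jacobi i j k ij jk ik n (h1 : j + k = jk) (h2 : i + jk = n)
    (h3 : i + j = ij) (h4 : ij + k = n) (h5 : i + k = ik) (h6 : j + ik = n) a b c :
  dga_br h2 a (dga_br h1 b c) =
    dga_br h4 (dga_br h3 a b) c + zsign R (i * j) *: dga_br h6 b (dga_br h5 a c).
Proof.
rewrite /dga_br !(dga_mulB, dga_Bmul, dga_mulZ, dga_Zmul).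
rewrite (dga_assoc h3 h1 h4 h2) (dga_assoc h1 (addC_eq h5) (addC_eq h2) h6).
rewrite (dga_assoc (addC_eq h1) (addC_eq h3) (addC_eq h2) (addC_eq h4)).
rewrite (dga_assoc (addC_eq h3) h5 h4 h6).
rewrite (dga_assoc h5 (addC_eq h1) (addC_eq h6) h2).
rewrite (dga_assoc (addC_eq h5) h3 (addC_eq h6) (addC_eq h4)).
have -> : zsign R (i * jk) = zsign R (i * j) * zsign R (i * k).
  by rewrite -h1 mulrDr zsignD.
have -> : zsign R (ij * k) = zsign R (i * k) * zsign R (j * k).
  by rewrite -h3 mulrDl zsignD.
have -> : zsign R (j * ik) = zsign R (i * j) * zsign R (j * k).
  by rewrite -h5 mulrDr zsignD [j * i]mulrC.
move: (zsign_sqr R (i * j)) (zsign_sqr R (i * k)).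
move: (zsign R (i * j)) (zsign R (i * k)) (zsign R (j * k)) => x y z xx yy.
rewrite !(scalerBr, scalerA, opprB) !mulrA xx !mul1r.
have -> : y * z * x = x * y * z by rewrite mulrC mulrA.
rewrite [z * y]mulrC [RHS]addrACA !addrA !subrK.
by rewrite -!addrA; congr (_ + _); rewrite [LHS]addrC -addrA [LHS]addrCA.
Qed.

Lemma dga_br_odd i k n (h : i + i = k) (h' : i + k = n) b : odd `|i|%N ->
  dga_br h' b (dga_br h b b) = 0.
Proof.
move=> _; rewrite /dga_br !(dga_mulB, dga_Bmul, dga_mulZ, dga_Zmul).
rewrite (dga_mulE (addC_eq h) h) (dga_assoc h h (addC_eq h') h').
have -> : zsign R (i * k) = 1 by rewrite -h mulrDr zsignD zsign_sqr.
by rewrite scale1r subrr.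
Qed.

Definition dga_lie : dglie R :=
  Dglie dga_br_linl dga_br_linr dga_br_anti dga_br_even dga_br_leibniz
    dga_br_jacobi dga_br_odd.

End CommutatorLie.

(* Hom^*(C, C) for a cochain complex C *)
Section EndDga.
Variables (R : comPzRingType) (C : complex R).

Record ghom (k : int) : Type :=
  Ghom { ghomf :> forall p q, p + k = q -> {linear C p -> C q} }.

Section GhomLmod.
Variable k : int.
Implicit Types a b : ghom k.

Lemma ghom_eq_map a b : (forall p q (h : p + k = q), a p q h = b p q h) -> a = b.
Proof.
case: a b => [a] [b] /= e; congr Ghom.
apply: functional_extensionality_dep => p; apply: functional_extensionality_dep => q.
exact: functional_extensionality_dep.
Qed.

Lemma ghom_eq a b : (forall p q (h : p + k = q) x, a p q h x = b p q h x) -> a = b.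
Proof. by move=> e; apply: ghom_eq_map => p q h; apply: linear_map_eq => x. Qed.

HB.instance Definition _ := gen_eqMixin (ghom k).
HB.instance Definition _ := gen_choiceMixin (ghom k).

Definition ghom_zero := Ghom (fun p q (_ : p + k = q) => 0).
Definition ghom_add a b := Ghom (fun p q h => a p q h + b p q h).
Definition ghom_opp a := Ghom (fun p q h => - a p q h).
Definition ghom_scale (c : R) a := Ghom (fun p q h => c *: a p q h).

Lemma ghom_addA : associative ghom_add.
Proof. by move=> a b c; apply: ghom_eq_map => p q h /=; rewrite addrA. Qed.
Lemma ghom_addC : commutative ghom_add.
Proof. by move=> a b; apply: ghom_eq_map => p q h /=; rewrite addrC. Qed.
Lemma ghom_add0 : left_id ghom_zero ghom_add.
Proof. by move=> a; apply: ghom_eq_map => p q h /=; rewrite add0r. Qed.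
Lemma ghom_addN : left_inverse ghom_zero ghom_opp ghom_add.
Proof. by move=> a; apply: ghom_eq_map => p q h /=; rewrite addNr. Qed.

HB.instance Definition _ := GRing.isZmodule.Build (ghom k)
  ghom_addA ghom_addC ghom_add0 ghom_addN.

Lemma ghom_scaleA s t a : ghom_scale s (ghom_scale t a) = ghom_scale (s * t) a.
Proof. by apply: ghom_eq_map => p q h /=; rewrite scalerA. Qed.
Lemma ghom_scale1 : left_id 1 ghom_scale.
Proof. by move=> a; apply: ghom_eq_map => p q h /=; rewrite scale1r. Qed.
Lemma ghom_scaleDr : right_distributive ghom_scale +%R.
Proof. by move=> s a b; apply: ghom_eq_map => p q h /=; rewrite scalerDr. Qed.
Lemma ghom_scaleDl a : {morph ghom_scale^~ a : s t / s + t}.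
Proof. by move=> s t; apply: ghom_eq_map => p q h /=; rewrite scalerDl. Qed.

HB.instance Definition _ := GRing.Zmodule_isLmodule.Build R (ghom k)
  ghom_scaleA ghom_scale1 ghom_scaleDr ghom_scaleDl.

Lemma ghomDE a b p q (h : p + k = q) x : (a + b) p q h x = a p q h x + b p q h x.
Proof. by []. Qed.
Lemma ghomZE c a p q (h : p + k = q) x : (c *: a) p q h x = c *: a p q h x.
Proof. by []. Qed.
Lemma ghom0E p q (h : p + k = q) x : (0 : ghom k) p q h x = 0.
Proof. by []. Qed.

End GhomLmod.

Lemma ghom_mul_deg (i j k p q : int) : i + j = k -> p + k = q -> p + j + i = q.
Proof. by move=> <- <-; rewrite -addrA [j + i]addrC. Qed.

Definition ghom_mul i j k (h : i + j = k) (a : ghom i) (b : ghom j) : ghom k :=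
  Ghom (fun p q hq =>
    a (p + j) q (ghom_mul_deg h hq) \o b p (p + j) erefl).

Lemma ghom_mulE i j k (h : i + j = k) (a : ghom i) (b : ghom j) p m q
    (hq : p + k = q) (hm : p + j = m) (hm' : m + i = q) x :
  ghom_mul h a b p q hq x = a m q hm' (b p m hm x).
Proof. by case: m / hm hm' => hm' /=; rewrite (eq_irrelevance hm' (ghom_mul_deg h hq)). Qed.

Definition ghom_one : ghom 0 :=
  Ghom (fun p q h => ecast q {linear C p -> C q} (etrans (esym (addr0 p)) h) idfun).

Lemma ghom_d_deg1 (i j p q : int) : i + 1 = j -> p + j = q -> p + i + 1 = q.
Proof. by move=> <- <-; rewrite addrA. Qed.
Lemma ghom_d_deg2 (i j p q : int) : i + 1 = j -> p + j = q -> p + 1 + i = q.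
Proof. by move=> <- <-; rewrite -addrA [1 + i]addrC. Qed.

Definition ghom_d_fun i j (h : i + 1 = j) (a : ghom i) : ghom j :=
  Ghom (fun p q hq =>
    (cxd (ghom_d_deg1 h hq) \o a p (p + i) erefl : {linear C p -> C q})
    - zsign R i *:
      (a (p + 1) q (ghom_d_deg2 h hq) \o cxd (erefl (p + 1)) : {linear C p -> C q})).

Lemma ghom_dE i j (h : i + 1 = j) (a : ghom i) p q (hq : p + j = q) m1 m2
    (h1 : p + i = m1) (h1' : m1 + 1 = q) (h2 : p + 1 = m2) (h2' : m2 + i = q) x :
  ghom_d_fun h a p q hq x =
    cxd h1' (a p m1 h1 x) - zsign R i *: a m2 q h2' (cxd h2 x).
Proof.
case: m1 / h1 h1' => h1'; case: m2 / h2 h2' => h2' /=.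
by rewrite (eq_irrelevance h1' (ghom_d_deg1 h hq)) (eq_irrelevance h2' (ghom_d_deg2 h hq)).
Qed.

Lemma ghom_d_linear i j (h : i + 1 = j) : linear (ghom_d_fun h).
Proof.
move=> s a b; apply: ghom_eq => p q hq x.
have dE c := ghom_dE h c hq erefl (ghom_d_deg1 h hq) erefl (ghom_d_deg2 h hq) x.
rewrite ghomDE ghomZE !dE !ghomDE !ghomZE linearP !scalerDr opprD addrACA.
by rewrite !scalerN !scalerA [_ * s]mulrC.
Qed.

HB.instance Definition _ i j (h : i + 1 = j) :=
  GRing.isLinear.Build R (ghom i) (ghom j) *:%R (ghom_d_fun h) (ghom_d_linear h).

Lemma ghom_dd i j k (h : i + 1 = j) (h' : j + 1 = k) (a : ghom i) :
  ghom_d_fun h' (ghom_d_fun h a) = 0.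
Proof.
apply: ghom_eq => p q hq x; rewrite ghom0E.
have e1 : p + i + 1 = p + j by rewrite -h addrA.
have e2 : p + 1 + i = p + j by rewrite -h addrAC addrA.
have e3 : p + j + 1 = q by rewrite -hq -h' addrA.
have e4 : p + 1 + j = q by rewrite addrAC.
have e5 : p + 1 + 1 + i = q by rewrite -e4 -h addrAC addrA.
rewrite (ghom_dE h' _ hq erefl e3 erefl e4).
rewrite (ghom_dE h _ (erefl (p + j)) erefl e1 erefl e2).
rewrite (ghom_dE h _ e4 e2 e3 erefl e5).
rewrite linearB linearZ /= !cxdd linear0 scaler0 subr0 sub0r.
have -> : zsign R j = - zsign R i by rewrite -h zsignD zsign1 mulrN1.
by rewrite scaleNr opprK addNr.
Qed.

Definition end_cx : complex R :=
  @Complex R ghom (fun i j h => ghom_d_fun h) ghom_dd.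

Lemma ghom_mul_linl i j k (h : i + j = k) b : linear (fun a => ghom_mul h a b).
Proof. by move=> s x y; apply: ghom_eq. Qed.
Lemma ghom_mul_linr i j k (h : i + j = k) a : linear (ghom_mul h a).
Proof. by move=> s x y; apply: ghom_eq => p q hq z; rewrite /= linearP. Qed.

Lemma ghom_mulA i j k ij jk n (h1 : i + j = ij) (h2 : j + k = jk)
    (h3 : ij + k = n) (h4 : i + jk = n) a b c :
  ghom_mul h3 (ghom_mul h1 a b) c = ghom_mul h4 a (ghom_mul h2 b c).
Proof.
apply: ghom_eq => p q hq x.
have e1 : p + k + ij = q by rewrite -hq -h3 addrAC addrA.
have e2 : p + jk + i = q by rewrite -hq -h4 addrAC addrA.
have e3 : p + k + j = p + jk by rewrite -h2 addrAC addrA.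
rewrite (ghom_mulE h3 _ _ hq erefl e1) (ghom_mulE h4 _ _ hq erefl e2).
by rewrite (ghom_mulE h1 _ _ e1 e3 e2) (ghom_mulE h2 _ _ erefl erefl e3).
Qed.

Lemma ghom_oneE p q (h : p + 0 = q) (e : p = q) x : ghom_one p q h x = ecast q (C q) e x.
Proof.
rewrite /=; move: (etrans _ _) => e'; rewrite (eq_irrelevance e' e).
by case: q / e {h e'}.
Qed.

Lemma ghom_mul1l i (h : 0 + i = i) (a : ghom i) : ghom_mul h ghom_one a = a.
Proof.
apply: ghom_eq => p q hq x.
by rewrite (ghom_mulE _ _ _ hq hq (addr0 q)) (ghom_oneE _ erefl).
Qed.

Lemma ghom_mul1r i (h : i + 0 = i) (a : ghom i) : ghom_mul h a ghom_one = a.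
Proof.
apply: ghom_eq => p q hq x.
by rewrite (ghom_mulE _ _ _ hq (addr0 p) hq) (ghom_oneE _ erefl).
Qed.

Lemma ghom_leibniz i j k i' j' k' (h : i + j = k) (hk : k + 1 = k')
    (hi : i + 1 = i') (hj : j + 1 = j') (h1 : i' + j = k') (h2 : i + j' = k') a b :
  ghom_d_fun hk (ghom_mul h a b) =
    ghom_mul h1 (ghom_d_fun hi a) b + zsign R i *: ghom_mul h2 a (ghom_d_fun hj b).
Proof.
apply: ghom_eq => p q hq x; rewrite ghomDE ghomZE.
have e1 : p + j + i = p + k by rewrite -h addrAC addrA.
have e2 : p + k + 1 = q by rewrite -hq -hk addrA.
have e3 : p + 1 + k = q by rewrite addrAC.
have e4 : p + 1 + j + i = q by rewrite -e3 -h addrAC addrA.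
have e5 : p + j + 1 = p + j' by rewrite -hj addrA.
have e6 : p + j + i' = q by rewrite -hq -h1 addrAC addrA.
have e7 : p + j' + i = q by rewrite -hq -h2 addrAC addrA.
have e8 : p + 1 + j = p + j' by rewrite -hj addrAC addrA.
rewrite (ghom_dE hk _ hq erefl e2 erefl e3).
rewrite (ghom_mulE h _ _ erefl erefl e1) (ghom_mulE h _ _ e3 e8 e7).
rewrite (ghom_mulE h1 _ _ hq erefl e6) (ghom_mulE h2 _ _ hq erefl e7).
rewrite (ghom_dE hi _ e6 e1 e2 e5 e7) (ghom_dE hj _ erefl erefl e5 erefl e8).
have -> : zsign R k = zsign R i * zsign R j by rewrite -h zsignD.
rewrite linearB linearZ /= scalerBr [a _ _ _ (_ *: _)]linearZ /= scalerN scalerA.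
by rewrite addrA subrK.
Qed.

Definition end_dga : dga R :=
  @Dga R end_cx ghom_mul ghom_one ghom_mul_linl ghom_mul_linr ghom_mulA
    ghom_mul1l ghom_mul1r ghom_leibniz.

End EndDga.

Section ExtDga.
Variables (R : comPzRingType) (M : lmodType R).

Definition ext_cx : complex R :=
  @Complex R (extpow M) (fun i j _ => \0) (fun i j k _ _ x => erefl).

Lemma extpow_mul_deg i j k (h : i + j = k) (x : extpow M i) (y : extpow M j) :
  extval x * extval y \in homog k.
Proof. by rewrite -h; apply: homog_mul; apply: extvalP. Qed.

Definition extpow_mul i j k (h : i + j = k) (x : extpow M i) (y : extpow M j) :
  extpow M k := ExtPow (extpow_mul_deg h x y).

Definition extpow_one : extpow M 0 := ExtPow (homog_wedge (M := M) [::]).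

Lemma extpow_mul_linl i j k (h : i + j = k) y : linear (fun x => extpow_mul h x y).
Proof. by move=> a x z; apply: val_inj; apply: (ext_mulDl (val y)). Qed.
Lemma extpow_mul_linr i j k (h : i + j = k) x : linear (extpow_mul h x).
Proof. by move=> a y z; apply: val_inj; apply: (ext_mulDr (val x)). Qed.
Lemma extpow_mulA i j k ij jk n (h1 : i + j = ij) (h2 : j + k = jk)
    (h3 : ij + k = n) (h4 : i + jk = n) x y z :
  extpow_mul h3 (extpow_mul h1 x y) z = extpow_mul h4 x (extpow_mul h2 y z).
Proof. by apply: val_inj; rewrite /= mulrA. Qed.
Lemma extpow_mul1l i (h : 0 + i = i) x : extpow_mul h extpow_one x = x.
Proof. by apply: val_inj; rewrite /= mul1r. Qed.
Lemma extpow_mul1r i (h : i + 0 = i) x : extpow_mul h x extpow_one = x.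
Proof. by apply: val_inj; rewrite /= mulr1. Qed.
Lemma extpow_leibniz i j k i' j' k' (h : i + j = k) (hk : k + 1 = k')
    (hi : i + 1 = i') (hj : j + 1 = j') (h1 : i' + j = k') (h2 : i + j' = k')
    (x : ext_cx i) (y : ext_cx j) :
  (cxd hk (extpow_mul h x y : ext_cx k) : ext_cx k') =
    extpow_mul h1 (cxd hi x) y + zsign R i *: extpow_mul h2 x (cxd hj y).
Proof. by apply: val_inj => /=; rewrite mul0r mulr0 scaler0 addr0. Qed.

Definition ext_dga : dga R :=
  @Dga R ext_cx extpow_mul extpow_one extpow_mul_linl extpow_mul_linr extpow_mulA
    extpow_mul1l extpow_mul1r extpow_leibniz.

End ExtDga.

Section Koszul.
Variables (R : comPzRingType) (E : lmodType R) (f : {linear E -> R^o}).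

Lemma koszul_deg i j (h : i + 1 = j) (x : extpow E (- i)) :
  contr1 f (extval x) \in homog (- j).
Proof. by rewrite -h opprD; apply/homog_contr1/extvalP. Qed.

Definition koszul_d i j (h : i + 1 = j) (x : extpow E (- i)) : extpow E (- j) :=
  ExtPow (koszul_deg h x).

Lemma koszul_d_linear i j (h : i + 1 = j) : linear (koszul_d h).
Proof. by move=> a x y; apply: val_inj; rewrite /= contr1_linear. Qed.

HB.instance Definition _ i j (h : i + 1 = j) :=
  GRing.isLinear.Build R (extpow E (- i)) (extpow E (- j)) *:%R
    (koszul_d h) (koszul_d_linear h).

Lemma koszul_dd i j k (h : i + 1 = j) (h' : j + 1 = k) x :
  koszul_d h' (koszul_d h x) = 0.
Proof. by apply: val_inj; apply: contr1_contr1. Qed.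

Definition koszul : complex R :=
  @Complex R (fun j => extpow E (- j)) (fun i j h => koszul_d h) koszul_dd.

End Koszul.

Definition is_basis (R : comPzRingType) (E : lmodType R) n (e : 'I_n -> E) : Prop :=
  forall v : E, exists! c : {ffun 'I_n -> R}, v = \sum_i c i *: e i.

(* Main.v *)
Require Import Defs.
From HB Require Import structures.
From mathcomp Require Import all_boot all_order all_algebra.
From mathcomp Require Import boolp zify.
Import GRing.Theory.
Local Open Scope ring_scope.

Set Implicit Arguments.
Unset Strict Implicit.
Unset Printing Implicit Defensive.

(* Contractions by two forms anticommute, hence [i] is a morphism of differential
   graded algebras, and it sends the graded commutative algebra of forms, which is
   an abelian DG-Lie algebra, to the endomorphisms of the Koszul complex.

   For the surjectivity, let [y] be a cocycle of degree [i].  Its component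
   [/\^i E -> R] is the contraction by some [psi], because a finite basis of [E]
   gives mutually dual bases of [/\^i E] and [/\^i E^vee]; and [y - i_psi] is
   null-homotopic, because its component with values in [K^0] vanishes, the
   [/\^m E] are free and [K] is exact outside degree 0: a homotopy is built by
   lifting along the differential on the basis words, by induction on [m]. *)

(** * Signs in the exterior algebra and projection to degree 0 *)

Section ExteriorSigns.
Variables (R : comPzRingType) (M : lmodType R).
Implicit Types (s t : seq M) (x y : ext M).

(** Polarization: expand the square of [u + v], which is zero. *)
Lemma wedge1_anti (u v : M) :
  wedge [:: u] * wedge [:: v] = - (wedge [:: v] * wedge [:: u]).
Proof.
have := wedge_sqr (u + v).
have -> : wedge [:: u + v] = wedge [:: u] + wedge [:: v].
  by have := wedge1_linear 1 u v; rewrite !scale1r.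
rewrite mulrDl !mulrDr !wedge_sqr add0r addr0 => /eqP.
by rewrite addr_eq0 => /eqP.
Qed.

Lemma wedge1_mul (v : M) t :
  wedge [:: v] * wedge t = (-1) ^+ size t *: (wedge t * wedge [:: v]).
Proof.
elim: t => [|u t IH]; first by rewrite wedge0 mulr1 mul1r scale1r.
rewrite (wedge_cons u t) mulrA wedge1_anti mulNr -[in LHS]mulrA IH -ext_scaleAr mulrA.
by rewrite exprS mulN1r scaleNr.
Qed.

Lemma wedge_mulC s t :
  wedge s * wedge t = (-1) ^+ (size s * size t) *: (wedge t * wedge s).
Proof.
elim: s => [|v s IH]; first by rewrite wedge0 mulr1 mul1r scale1r.
rewrite (wedge_cons v s) -[in LHS]mulrA IH -ext_scaleAr mulrA wedge1_mul -ext_scaleAl scalerA.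
by rewrite -mulrA /= mulSn exprD mulrC.
Qed.

Lemma homog_ind k (P : ext M -> Prop) :
  (forall s, (size s)%:Z = k -> P (wedge s)) -> P 0 ->
  (forall a x y, P x -> P y -> P (a *: x + y)) ->
  forall x, x \in homog k -> P x.
Proof.
move=> Pw P0 PD _ /homogP[y hy ->]; rewrite /fsum_eval.
elim: y hy => [|c y IH] /=; first by rewrite big_nil.
by move=> /andP[/eqP hc /IH hy]; rewrite big_cons; apply: PD => //; apply: Pw.
Qed.

Lemma ext_ind (P : ext M -> Prop) :
  (forall s, P (wedge s)) -> P 0 ->
  (forall a x y, P x -> P y -> P (a *: x + y)) -> forall x, P x.
Proof.
move=> Pw P0 PD x; rewrite (ext_wedgeE x) /fsum_eval.
elim: (repr x) => [|c y IH]; first by rewrite big_nil.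
by rewrite big_cons; apply: PD.
Qed.

(** Both sides are bilinear, so words suffice, where this is [wedge_mulC]. *)
Lemma ext_gradedC i j x y : x \in homog i -> y \in homog j ->
  x * y = zsign R (i * j) *: (y * x).
Proof.
move=> hx hy.
move: x hx; apply: homog_ind => [s <-||a x z IHx IHz].
- move: y hy; apply: homog_ind => [t <-||a x z IHx IHz].
  + by rewrite wedge_mulC /zsign -PoszM absz_nat.
  + by rewrite mul0r mulr0 scaler0.
  + rewrite mulrDr mulrDl scalerDr -ext_scaleAr -ext_scaleAl IHx IHz.
    by rewrite !scalerA mulrC.
- by rewrite mul0r mulr0 scaler0.
- rewrite mulrDr mulrDl scalerDr -ext_scaleAr -ext_scaleAl IHx IHz.
  by rewrite !scalerA mulrC.
Qed.

Lemma homog_lt0 k x : k < 0 -> x \in homog k -> x = 0.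
Proof.
move=> k0; move: x; apply: homog_ind => [s sk||a x y -> ->] //.
  by rewrite -sk in k0.
by rewrite scaler0 addr0.
Qed.

(** Word-level form of the projection of the exterior algebra onto its degree 0 part [R]. *)
Definition augmentation_word s : R^o := if s is [::] then 1 else 0.

Lemma augmentation_word_alternating : alternating augmentation_word.
Proof.
by split=> [[|? ?] t a u v|[|? ?] t v] //=; rewrite scaler0 addr0.
Qed.

Definition augmentation : ext M -> R^o := ext_lift augmentation_word.

HB.instance Definition _ := GRing.isLinear.Build R (ext M) R^o *:%R
  augmentation (ext_liftP augmentation_word_alternating).

Lemma augmentation_wedge s : augmentation (wedge s) = augmentation_word s.
Proof. exact: ext_lift_wedge augmentation_word_alternating. Qed.

Lemma augmentation_homog0 x : x \in homog 0 -> (augmentation x : R) *: (1 : ext M) = x.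
Proof.
move: x; apply: homog_ind => [[|//] _||a x y IHx IHy].
- by rewrite augmentation_wedge scale1r wedge0.
- by rewrite linear0 scale0r.
- by rewrite linearP /= scalerDl -scalerA IHx IHy.
Qed.

Lemma augmentation_homog k x : k != 0 -> x \in homog k -> augmentation x = 0.
Proof.
move=> k0; move: x; apply: homog_ind => [s sk||a x y IHx IHy].
- by rewrite augmentation_wedge; case: s sk k0 => //= <-.
- by rewrite linear0.
- by rewrite linearP /= IHx IHy scaler0 addr0.
Qed.

Lemma augmentation_mul v x : augmentation (wedge [:: v] * x) = 0.
Proof.
move: x; apply: ext_ind => [s||a x y IHx IHy].
- by rewrite -wedge_cons augmentation_wedge.
- by rewrite mulr0 linear0.
- by rewrite mulrDr -ext_scaleAr linearP /= IHx IHy scaler0 addr0.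
Qed.

End ExteriorSigns.

(** * Contraction as a morphism of differential graded algebras *)

Section ContractionMorphism.
Variables (R : comPzRingType) (E : lmodType R).
Local Notation dual := {linear E -> R^o}.
Implicit Types (g : dual) (x : ext E) (psi phi : ext dual).

HB.instance Definition _ psi := GRing.isLinear.Build R (ext E) (ext E) *:%R
  (contr psi) (contr_linear psi).

Lemma contr_linearl x a psi phi :
  contr (a *: psi + phi) x = a *: contr psi x + contr phi x.
Proof. exact: contr_linear_form. Qed.

Lemma contr0l x : contr 0 x = 0.
Proof. by have := contr_linearl x (-1) 0 0; rewrite scaler0 addr0 scaleN1r addNr. Qed.

(** Polarization of [contr1_contr1] at the form [g + h]. *)
Lemma contr1_anti g (h : dual) x : contr1 g (contr1 h x) = - contr1 h (contr1 g x).
Proof.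
have D a b y : contr1 (a + b) y = contr1 a y + contr1 b y.
  by have := contr1_linear_form y 1 a b; rewrite !scale1r.
have := contr1_contr1 (g + h) x.
rewrite !D !raddfD /= !contr1_contr1 add0r addr0 => /eqP.
by rewrite addrC addr_eq0 => /eqP ->; rewrite ?opprK.
Qed.

Lemma contr_mul psi phi x : contr (psi * phi) x = contr psi (contr phi x).
Proof.
move: psi; apply: ext_ind => [s||a y z IHy IHz].
- move: phi; apply: ext_ind => [t||a y z IHy IHz].
  + by rewrite -wedgeM !contr_wedge foldr_cat.
  + by rewrite mulr0 !contr0l linear0.
  + by rewrite mulrDr -ext_scaleAr !contr_linearl linearP IHy IHz.
- by rewrite mul0r !contr0l.
- by rewrite mulrDl -ext_scaleAl !contr_linearl IHy IHz.
Qed.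

Lemma contr_one x : contr 1 x = x.
Proof. by rewrite -wedge0 contr_wedge. Qed.

Lemma homog_contr k j psi x :
  psi \in homog k -> x \in homog j -> contr psi x \in homog (j - k).
Proof.
move=> hpsi hx; move: psi hpsi; apply: homog_ind => [s <-||a y z IHy IHz].
- rewrite contr_wedge; elim: s => [|g s IH] /=; first by rewrite subr0.
  by rewrite -addn1 PoszD opprD addrA; apply: homog_contr1.
- by rewrite contr0l rpred0.
- by rewrite contr_linearl rpredD // rpredZ.
Qed.

(** Moving [g] past each of the [k] forms costs one sign. With [g = f] this makes [contr psi] a
    cocycle of the endomorphism complex. *)
Lemma contr1_contr k g psi x : psi \in homog k ->
  contr1 g (contr psi x) = zsign R k *: contr psi (contr1 g x).
Proof.
move=> hpsi; move: psi hpsi; apply: homog_ind => [s <-||a y z IHy IHz].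
- rewrite !contr_wedge /zsign absz_nat.
  elim: s => [|h s IH] /=; first by rewrite scale1r.
  by rewrite contr1_anti IH linearZ /= exprS mulN1r scaleNr.
- by rewrite !contr0l linear0 scaler0.
- rewrite !contr_linearl linearP /= scalerDr IHy IHz.
  by rewrite !scalerA mulrC.
Qed.

Variable f : dual.

(** The degree is subtracted because the Koszul complex in degree [p] is the exterior power of
    degree [- p]. *)
Definition graded_op (k : int) (Z : ext E -> ext E) : Prop :=
  forall j x, x \in homog j -> Z x \in homog (j - k).

Lemma graded_op_deg k Z (hZ : graded_op k Z) p q (h : p + k = q)
  (x : extpow E (- p)) : Z (extval x) \in homog (- q).
Proof. by rewrite -h opprD; apply: hZ; apply: extvalP. Qed.

Section GhomOfOp.
Variables (k : int) (Z : {linear ext E -> ext E}) (hZ : graded_op k Z).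

Definition op_fun p q (h : p + k = q) (x : koszul f p) : koszul f q :=
  ExtPow (graded_op_deg hZ h x).

Lemma op_fun_linear p q (h : p + k = q) : linear (op_fun h).
Proof. by move=> a x y; apply: val_inj; rewrite /= linearP. Qed.

HB.instance Definition _ p q (h : p + k = q) :=
  GRing.isLinear.Build R (koszul f p) (koszul f q) *:%R
    (op_fun h) (op_fun_linear h).

Definition ghom_of_op : ghom (koszul f) k := Ghom (fun p q (hq : p + k = q) => op_fun hq).

End GhomOfOp.

Lemma ghom_ext k (a b : ghom (koszul f) k) :
  (forall p q (h : p + k = q) (x : koszul f p), extval (ghomf a h x) = extval (ghomf b h x)) -> a = b.
Proof. by move=> ab; apply: ghom_eq => p q h x; apply: val_inj; apply: ab. Qed.

Definition contr_ghom k (psi : extpow dual k) : ghom (koszul f) k :=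
  ghom_of_op (fun j x hx => homog_contr (extvalP psi) hx).

Lemma contr_ghom_linear k : linear (@contr_ghom k).
Proof.
by move=> a psi phi; apply: ghom_ext => p q h x; apply: (contr_linear_form x).
Qed.

HB.instance Definition _ k :=
  GRing.isLinear.Build R (extpow dual k) (ghom (koszul f) k) *:%R
    (@contr_ghom k) (@contr_ghom_linear k).

Lemma contr_ghom_d i j (h : i + 1 = j) (psi : ext_cx dual i) :
  contr_ghom (cxd h psi) = cxd h (contr_ghom psi : end_cx (koszul f) i).
Proof.
apply: ghom_ext => p q hq x; rewrite /= contr0l.
by rewrite (contr1_contr _ _ (extvalP psi)) subrr.
Qed.

Definition contr_cx_hom : cx_hom (ext_cx dual) (end_cx (koszul f)) :=
  @CxHom R (ext_cx dual) (end_cx (koszul f)) (fun k => @contr_ghom k) contr_ghom_d.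

Lemma contr_ghom_mul i j k (h : i + j = k) (a : extpow dual i) (b : extpow dual j) :
  contr_ghom (extpow_mul h a b) = ghom_mul h (contr_ghom a) (contr_ghom b).
Proof. by apply: ghom_ext => p q hq x; rewrite /= contr_mul. Qed.

Lemma contr_ghom_one : contr_ghom (extpow_one dual) = ghom_one (koszul f).
Proof.
apply: ghom_ext => p q h x.
have e : p = q by rewrite -h addr0.
by case: q / e h => h; rewrite (ghom_oneE h erefl) /= contr_one.
Qed.

Definition contr_dga_hom : dga_hom (ext_dga dual) (end_dga (koszul f)) :=
  @DgaHom R (ext_dga dual) (end_dga (koszul f)) contr_cx_hom
    contr_ghom_mul contr_ghom_one.

End ContractionMorphism.

(** * Commutator DG-Lie algebras and the zigzag *)

Section DgaLie.
Variable R : comPzRingType.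

Lemma dga_hom_br (A B : dga R) (phi : dga_hom A B) i j k (h : i + j = k) a b :
  phi k (dga_br h a b) = dga_br h (phi i a) (phi j b).
Proof. by rewrite /dga_br linearB linearZ /= !dgah_mul. Qed.

Definition dga_lie_hom (A B : dga R) (phi : dga_hom A B) :
  dgl_hom (dga_lie A) (dga_lie B) :=
  @DglHom R (dga_lie A) (dga_lie B) phi (@dga_hom_br A B phi).

Definition dgl_id (L : dglie R) : dgl_hom L L :=
  @DglHom R L L (@CxHom R L L (fun i => idfun) (fun i j h x => erefl))
    (fun i j k h a b => erefl).

Lemma ext_lie_abelian (M : lmodType R) : dgl_abelian (dga_lie (ext_dga M)).
Proof.
move=> i j k h a b; apply: val_inj.
by rewrite /= (ext_gradedC (extvalP a) (extvalP b)) subrr.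
Qed.

(** One zigzag step suffices: [phi] on the left and, on the right, the identity of the exterior
    algebra, which is abelian by graded commutativity. *)
Lemma nha_of_surjective (M : lmodType R) (A : dga R) (phi : dga_hom (ext_dga M) A) :
  surjective_in_cohomology phi -> numerically_homotopy_abelian (dga_lie A).
Proof.
move=> phi_surj.
apply: (@Nha_last R _ _ _ (dga_lie_hom phi) (dgl_id _)) => //.
exact: ext_lie_abelian.
Qed.

End DgaLie.

(** * Dual bases of the exterior powers *)

Section ExteriorBasis.
Variables (R : comPzRingType) (E : lmodType R).
Local Notation dual := {linear E -> R^o}.
Variables (I : eqType) (e : I -> E) (d : I -> dual).
Hypothesis de : forall i j, d i (e j) = (i == j)%:R.
Implicit Types (i j : I) (s L : seq I) (x y z : ext E).

Definition basis_word s : ext E := wedge [seq e i | i <- s].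
(* The forms are reversed so that [dual_word s] is dual to [basis_word s]:
   [contr] applies the last form of a word first. *)
Definition dual_word s : ext dual := wedge (rev [seq d i | i <- s]).
Definition coord s x : R := augmentation (contr (dual_word s) x).

Lemma basis_word_homog s : basis_word s \in homog (size s)%:Z.
Proof. by have := homog_wedge [seq e i | i <- s]; rewrite size_map. Qed.

Lemma dual_word_homog s : dual_word s \in homog (size s)%:Z.
Proof. by have := homog_wedge (rev [seq d i | i <- s]); rewrite size_rev size_map. Qed.

Lemma coord_linear s a x y : coord s (a *: x + y) = a * coord s x + coord s y.
Proof. by rewrite /coord !linearP. Qed.

Lemma coord_nil x : coord [::] x = augmentation x.
Proof. by rewrite /coord /dual_word wedge0 contr_one. Qed.

Lemma coord_cons j s x : coord (j :: s) x = coord s (contr1 (d j) x).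
Proof.
rewrite /coord /dual_word /= rev_cons -cats1 wedgeM contr_mul.
by rewrite (contr_wedge [:: d j]).
Qed.

Lemma coord_homog s k x : k != (size s)%:Z -> x \in homog k -> coord s x = 0.
Proof.
move=> ks hx; apply: (@augmentation_homog _ _ (k - (size s)%:Z)).
  by rewrite subr_eq0.
exact: homog_contr (dual_word_homog s) hx.
Qed.

Lemma contr1_mul_neq i j x : i != j ->
  contr1 (d i) (wedge [:: e j] * x) = - (wedge [:: e j] * contr1 (d i) x).
Proof. by move=> /negbTE ij; rewrite contr1_cons de ij scale0r add0r. Qed.

Lemma contr1_mul_eq j x :
  contr1 (d j) (wedge [:: e j] * x) = x - wedge [:: e j] * contr1 (d j) x.
Proof. by rewrite contr1_cons de eqxx scale1r. Qed.

(** Each [d i] with [i] in [s] passes [e j] up to sign, so [e j] stays in front, and the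
    augmentation kills every product starting with a vector. *)
Lemma coord_mul_notin j s x : j \notin s -> coord s (wedge [:: e j] * x) = 0.
Proof.
elim: s x => [|i s IH] x; first by rewrite coord_nil augmentation_mul.
rewrite inE negb_or => /andP[ji js]; rewrite coord_cons contr1_mul_neq 1?eq_sym //.
by rewrite -mulrN IH.
Qed.

(** The subalgebra generated by the [e i] with [i] in [L]. *)
Inductive word_span L : ext E -> Prop :=
| word_span1 : word_span L 1
| word_span0 : word_span L 0
| word_spanD a x y : word_span L x -> word_span L y -> word_span L (a *: x + y)
| word_spanM i x : i \in L -> word_span L x -> word_span L (wedge [:: e i] * x).

Lemma word_span_nil x : word_span [::] x -> (augmentation x : R) *: (1 : ext E) = x.
Proof.
elim=> [||a {}x y _ IHx _ IHy|//].
- by rewrite -wedge0 augmentation_wedge scale1r.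
- by rewrite linear0 scale0r.
- by rewrite linearP /= scalerDl -scalerA IHx IHy.
Qed.

(** Contraction by [d j] is an antiderivation that vanishes on the generators [e i], as [j] is not
    in [L]. *)
Lemma word_span_contr1 L j x : j \notin L -> word_span L x -> contr1 (d j) x = 0.
Proof.
move=> jL; elim=> [||a {}x y _ IHx _ IHy|i {}x iL _ IH].
- exact: contr1_1.
- exact: linear0.
- by rewrite linearP /= IHx IHy scaler0 addr0.
- rewrite contr1_mul_neq ?IH ?mulr0 ?oppr0 //.
  by apply: contraNneq jL => ->.
Qed.

(** Every [e j] can be moved to the front, where a second one gives zero. *)
Lemma word_span_cons j L x : word_span (j :: L) x ->
  exists y z, [/\ word_span L y, word_span L z & x = y + wedge [:: e j] * z].
Proof.
elim=> [||a _ _ _ [y1 [z1 [Ly1 Lz1 ->]]] _ [y2 [z2 [Ly2 Lz2 ->]]]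
        |i _ + _ [y [z [Ly Lz ->]]]].
- exists 1, 0; split; [exact: word_span1|exact: word_span0|by rewrite mulr0 addr0].
- exists 0, 0; split; [exact: word_span0|exact: word_span0|by rewrite mulr0 addr0].
- exists (a *: y1 + y2), (a *: z1 + z2); split; try exact: word_spanD.
  by rewrite scalerDr mulrDr -ext_scaleAr addrACA.
- rewrite inE => /orP[/eqP->|iL].
    exists 0, y; split=> //; first exact: word_span0.
    by rewrite mulrDr mulrA wedge_sqr mul0r addr0 add0r.
  (* The sign of exchanging [e i] and [e j] is absorbed in the new [z]; the summand 0 fits the shape
     of [word_spanD]. *)
  exists (wedge [:: e i] * y), ((-1) *: (wedge [:: e i] * z) + 0); split.
  + exact: word_spanM.
  + by apply: word_spanD (word_span0 _); apply: word_spanM.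
  + by rewrite addr0 mulrDr !mulrA wedge1_anti scaleN1r mulrN mulNr mulrA.
Qed.

(** For a duplicate-free [L] these are the subsets of [L], each listed once in the order of [L];
    they index the basis words. *)
Fixpoint subwords L : seq (seq I) :=
  if L is j :: L' then subwords L' ++ [seq j :: s | s <- subwords L'] else [:: [::]].

Lemma subwords_sub L s : s \in subwords L -> {subset s <= L}.
Proof.
elim: L s => [|j L IH] s /=; first by rewrite inE => /eqP ->.
rewrite mem_cat => /orP[/IH sL i /sL iL|/mapP[t /IH tL ->] i].
  by rewrite inE iL orbT.
by rewrite !inE => /orP[->//|/tL ->]; rewrite orbT.
Qed.

Lemma subwords_size L s : s \in subwords L -> (size s <= size L)%N.
Proof.
elim: L s => [|j L IH] s /=; first by rewrite inE => /eqP ->.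
by rewrite mem_cat => /orP[/IH/leqW//|/mapP[t /IH tL ->]].
Qed.

(* Induction on [L]: [e_j /\ z] is recovered from [x = y + e_j /\ z] by
   [z = d_j _| x], and the coordinates on words without [j] only see [y]. *)
Lemma word_span_expand L x : uniq L -> word_span L x ->
  x = \sum_(s <- subwords L) coord s x *: basis_word s.
Proof.
elim: L x => [|j L IH] x /=.
  by move=> _ hx; rewrite big_seq1 coord_nil; exact: esym (word_span_nil hx).
move=> /andP[jL uL] /word_span_cons[y [z [Ly Lz ->]]].
rewrite big_cat big_map; congr (_ + _).
  rewrite [LHS](IH _ uL Ly) big_seq [RHS]big_seq; apply: eq_bigr => s /subwords_sub sL.
  have js : j \notin s by apply: contra jL => /sL.
  by rewrite -[y in RHS]scale1r coord_linear coord_mul_notin // mul1r addr0.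
rewrite {1}(IH _ uL Lz) mulr_sumr; apply: eq_bigr => s _.
rewrite coord_cons linearD /= (word_span_contr1 jL Ly) add0r contr1_mul_eq.
rewrite (word_span_contr1 jL Lz) mulr0 subr0 -ext_scaleAr.
by rewrite -wedgeM.
Qed.

End ExteriorBasis.

(** * Endomorphisms of the Koszul complex as operators on the exterior algebra *)

Section KoszulEndomorphisms.
Variables (R : comPzRingType) (n : nat) (E : lmodType R) (e : 'I_n -> E).
Local Notation dual := {linear E -> R^o}.
Implicit Types (x y : ext E) (k : int).

Lemma dual_basis : is_basis e -> exists d : 'I_n -> dual,
  (forall i j, d i (e j) = (i == j)%:R) /\ (forall v, v = \sum_i (d i v : R) *: e i).
Proof.
move=> /(_ _)/constructive_indefinite_description he.
pose c v := sval (he v).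
have cE v : v = \sum_i c v i *: e i by case: (svalP (he v)).
(* Uniqueness of coordinates yields both their linearity and their values on the basis. *)
have cU v b : v = \sum_i b i *: e i -> c v =1 b.
  move=> vb i; have [_ /(_ (finfun b))] := svalP (he v).
  rewrite -/(c v) => -> //; first by rewrite ffunE.
  by rewrite {1}vb; apply: eq_bigr => ? _; rewrite ffunE.
have cL i : linear ((fun v => c v i) : E -> R^o).
  move=> a u v; apply: (cU _ (fun i => a * c u i + c v i)).
  rewrite {1}(cE u) {1}(cE v) scaler_sumr -big_split; apply: eq_bigr => j _ /=.
  by rewrite scalerDl scalerA.
pose d i : dual := HB.pack ((fun v => c v i) : E -> R^o)
  (GRing.isLinear.Build _ _ _ _ _ (cL i)).
exists d; split=> [i j|v]; last exact: cE.
apply: (cU _ (fun i => (i == j)%:R)).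
by rewrite (bigD1 j) //= eqxx scale1r big1 ?addr0 // => k /negbTE ->; rewrite scale0r.
Qed.

Variables (d : 'I_n -> dual) (f : dual).
Hypothesis de : forall i j, d i (e j) = (i == j)%:R.
Hypothesis e_span : forall v, v = \sum_i (d i v : R) *: e i.

Local Notation words := (subwords (enum 'I_n)).

(** Expand the letters of a word in the basis, one at a time. *)
Lemma word_span_full x : word_span e (enum 'I_n) x.
Proof.
move: x; apply: ext_ind => [s||a x y IHx IHy].
- elim: s => [|v s IH]; first by rewrite wedge0; apply: word_span1.
  rewrite wedge_cons (e_span v).
  have -> : wedge [:: \sum_i (d i v : R) *: e i] * wedge s =
            \sum_i (d i v : R) *: (wedge [:: e i] * wedge s).
    elim/big_rec2: _ => [|i y1 y2 _ <-].
      (* Linearity at the scalar -1 and zero vectors gives [wedge [:: 0] = 0]. *)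
      have := @wedge1_linear R E (-1) 0 0.
      by rewrite scaler0 addr0 scaleN1r addNr => ->; rewrite mul0r.
    by rewrite wedge1_linear mulrDl -ext_scaleAl.
  elim/big_rec: _ => [|i y _ IHy]; first exact: word_span0.
  by apply: word_spanD => //; apply: word_spanM; rewrite ?mem_enum.
- exact: word_span0.
- exact: word_spanD.
Qed.

Lemma ext_expand x : x = \sum_(s <- words) coord d s x *: basis_word e s.
Proof. exact: word_span_expand (enum_uniq _) (word_span_full x). Qed.

(** This is how linear maps are built from values [u s] prescribed on the basis words. *)
Definition coord_sum (N : lmodType R) (u : seq 'I_n -> N) x : N :=
  \sum_(s <- words) coord d s x *: u s.

Lemma coord_sum_linear (N : lmodType R) (u : seq 'I_n -> N) : linear (coord_sum u).
Proof.
move=> a x y; rewrite /coord_sum scaler_sumr -big_split; apply: eq_bigr => s _ /=.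
by rewrite coord_linear scalerDl scalerA.
Qed.

HB.instance Definition _ (N : lmodType R) (u : seq 'I_n -> N) :=
  GRing.isLinear.Build R (ext E) N *:%R (coord_sum u) (coord_sum_linear u).

Lemma coord_sum_homog (N : lmodType R) (u : seq 'I_n -> N) k x : x \in homog k ->
  coord_sum u x = \sum_(s <- words | (size s)%:Z == k) coord d s x *: u s.
Proof.
move=> hx; rewrite [RHS]big_mkcond; apply: eq_bigr => s _.
case: eqP => //= sk.
by rewrite (@coord_homog _ _ _ d s k x) ?scale0r // eq_sym; apply/eqP.
Qed.

Lemma linear_coord_sum (N : lmodType R) (Z : {linear ext E -> N}) x :
  Z x = coord_sum (fun s => Z (basis_word e s)) x.
Proof.
by rewrite {1}(ext_expand x) linear_sum; apply: eq_bigr => s _; rewrite linearZ.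
Qed.

Lemma homog_expand (N : lmodType R) (Z : {linear ext E -> N}) k x : x \in homog k ->
  Z x = \sum_(s <- words | (size s)%:Z == k) coord d s x *: Z (basis_word e s).
Proof. by move=> hx; rewrite linear_coord_sum (coord_sum_homog _ hx). Qed.

Lemma ext_linear_homog (N : lmodType R) (Y Z : {linear ext E -> N}) :
  (forall k x, x \in homog k -> Y x = Z x) -> Y =1 Z.
Proof.
move=> YZ x; rewrite (ext_expand x) !linear_sum; apply: eq_bigr => s _.
by rewrite !linearZ /= (YZ _ _ (basis_word_homog e s)).
Qed.

(* Graded endomorphisms of the Koszul complex are handled as graded operators on
   the whole of [ext E], which avoids transport along equalities of degrees. *)
Lemma op_of_ghom k (a : ghom (koszul f) k) :
  exists Z : {linear ext E -> ext E}, graded_op k Z /\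
    forall p q (h : p + k = q) (x : koszul f p),
      extval (ghomf a h x) = Z (extval x).
Proof.
have hw s : basis_word e s \in homog (- - (size s)%:Z).
  by rewrite opprK; apply: basis_word_homog.
pose w s : koszul f (- (size s)%:Z) := ExtPow (hw s).
pose u s := extval (ghomf a erefl (w s)).
(* The value on a basis word is [u s] whatever names the degrees have: both equations are eliminated
   once, here. *)
have uE p q (h : p + k = q) (x : koszul f p) s (sp : (size s)%:Z = - p) :
    extval x = basis_word e s -> extval (ghomf a h x) = u s.
  have {sp} sp : - (size s)%:Z = p by rewrite sp opprK.
  case: p / sp h x => h; case: q / h => x xs; rewrite /u.
  by congr extval; congr (ghomf a _ _); apply: val_inj.
pose Z : {linear ext E -> ext E} := coord_sum u.
have ZE p q (h : p + k = q) (x : koszul f p) : extval (ghomf a h x) = Z (extval x).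
  (* The default 0 serves words of the wrong length, which the filtered sums below omit. *)
  pose W s : koszul f p := insubd 0 (basis_word e s).
  have WE s : (size s)%:Z = - p -> extval (W s) = basis_word e s.
    by move=> sp; apply: insubdK; rewrite -sp; apply: basis_word_homog.
  have valE r (P : pred (seq 'I_n)) (c : seq 'I_n -> R) (v : seq 'I_n -> koszul f r) :
      extval (\sum_(s <- words | P s) c s *: v s) =
      \sum_(s <- words | P s) c s *: extval (v s).
    by elim/big_rec2: _ => //= s y1 y2 _ <-.
  have {1}-> : x = \sum_(s <- words | (size s)%:Z == - p) coord d s (extval x) *: W s.
    apply: val_inj; rewrite /= valE [LHS](homog_expand idfun (extvalP x)) /=.
    by apply: eq_bigr => s /eqP sp; rewrite WE.
  rewrite linear_sum [RHS](coord_sum_homog _ (extvalP x)).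
  under eq_bigr do rewrite linearZ /=.
  rewrite valE; apply: eq_bigr => s /eqP sp; congr (_ *: _).
  exact: uE sp (WE s sp).
exists Z; split=> // j x hx.
have hx' : x \in homog (- - j) by rewrite opprK.
have -> : j - k = - (- j + k) by rewrite opprD opprK.
have := extvalP (ghomf a (erefl (- j + k)) (ExtPow hx' : koszul f (- j))).
by rewrite ZE.
Qed.

(** In exterior degree [k], [Z] is a scalar-valued form; [psi] combines the dual words, weighted by
    the values of [Z] on the basis words of length [k]. *)
Lemma op_contr k (Z : {linear ext E -> ext E}) : graded_op k Z ->
  exists2 psi : ext dual, psi \in homog k &
    forall x, x \in homog k -> Z x = contr psi x.
Proof.
move=> hZ.
exists (\sum_(s <- words | (size s)%:Z == k)
          (augmentation (Z (basis_word e s)) : R) *: dual_word d s).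
  apply: rpred_sum => s /eqP <-; apply: rpredZ; exact: dual_word_homog.
move=> x hx; rewrite (homog_expand Z hx).
have -> (P : pred (seq 'I_n)) (c : seq 'I_n -> R) :
    contr (\sum_(s <- words | P s) c s *: dual_word d s) x =
    \sum_(s <- words | P s) c s *: contr (dual_word d s) x.
  by elim/big_rec2: _ => [|s y1 y2 _ <-]; rewrite ?contr0l ?contr_linearl.
apply: eq_bigr => s /eqP sk.
have hZw : Z (basis_word e s) \in homog 0.
  by rewrite -(subrr k); apply: hZ; rewrite -sk; apply: basis_word_homog.
have hdx : contr (dual_word d s) x \in homog 0.
  by rewrite -(subrr k); apply: homog_contr hx; rewrite -sk; apply: dual_word_homog.
(* Both elements have degree 0, so they are scalar multiples of 1 and the two scalars can be
   exchanged. *)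
rewrite -{1}(augmentation_homog0 hZw) -(augmentation_homog0 hdx) !scalerA.
by rewrite mulrC.
Qed.

(** * Construction of the null-homotopy *)

Section Homotopy.
Variables (i i0 : int) (Z : {linear ext E -> ext E}).
Hypotheses (i0i : i0 + 1 = i) (hZ : graded_op i Z).
Hypothesis fZ : forall x, contr1 f (Z x) = zsign R i *: Z (contr1 f x).
Hypothesis Z0 : forall x, x \in homog i -> Z x = 0.
Hypothesis f_exact : forall j x, j != 0 -> x \in homog j -> contr1 f x = 0 ->
  exists2 y, y \in homog (j + 1) & x = contr1 f y.

(* [Z x = [d, H] x], with the sign term moved to the right. *)
Let homotopy_at (H : ext E -> ext E) x :=
  contr1 f (H x) = Z x + zsign R i0 *: H (contr1 f x).

(* The condition [k = i0 -> u = 0] keeps the vanishing of the homotopy on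
   [/\^i0 E], needed in degree [k = i] where exactness is not available. *)
Lemma homotopy_lift k (H : ext E -> ext E) x : graded_op i0 H ->
  (forall y, y \in homog i0 -> H y = 0) ->
  homotopy_at H (contr1 f x) -> x \in homog k ->
  exists u, [/\ u \in homog (k - i0), k = i0 -> u = 0 &
    contr1 f u = Z x + zsign R i0 *: H (contr1 f x)].
Proof.
move=> hH H0 Hfx hx; have hfx := homog_contr1 f hx.
set y := Z x + _.
have hy : y \in homog (k - i).
  apply: rpredD; first exact: hZ.
  by apply: rpredZ; rewrite -i0i opprD addrA addrAC; apply: hH.
(* For [k = i] the element [y] has degree 0, outside the exact range; it vanishes by [Z0] and
   because [contr1 f x] has degree [i0]. *)
have [ki|ki] := eqVneq k i.
  exists 0; split=> //; first exact: rpred0.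
  by rewrite linear0 /y Z0 -?ki // H0 ?scaler0 ?addr0 // -[i0](addrK 1) i0i -ki.
(* For [k = i0] the element [y] has degree -1, hence is 0. *)
have [ki0|ki0] := eqVneq k i0.
  exists 0; split=> //; first exact: rpred0.
  by rewrite linear0 (homog_lt0 _ hy) // ki0 -i0i opprD addrA subrr.
(* The homotopy identity at [contr1 f x] cancels the term given by [fZ], since [i] and [i0] have
   opposite signs. *)
have fy : contr1 f y = 0.
  rewrite linearD linearZ /= fZ Hfx contr1_contr1 -i0i zsignD zsign1 mulrN1.
  have -> : H 0 = 0 by apply: H0; apply: rpred0.
  by rewrite scaler0 addr0 scaleNr addNr.
have [|u hu yu] := f_exact _ hy fy; first by rewrite subr_eq0.
exists u; split=> //; last by move/eqP: ki0.
have -> : k - i0 = k - i + 1 by rewrite -i0i opprD addrA subrK.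
exact: hu.
Qed.

(** The inductive step keeps [H] outside degree [m] and redefines it there by lifting on the basis
    words of length [m]. *)
Lemma partial_homotopy (m : nat) :
  exists H : {linear ext E -> ext E}, [/\ graded_op i0 H,
    forall x, x \in homog i0 -> H x = 0 &
    forall k x, k < m%:Z -> x \in homog k -> homotopy_at H x].
Proof.
elim: m => [|m [H [hH H0 Hm]]].
  (* Exterior powers of negative degree vanish, so the zero map starts the induction. *)
  exists \0; split=> // [j x _|k x k0 /(homog_lt0 k0) ->]; first exact: rpred0.
  by rewrite /homotopy_at /= !linear0 addr0.
(* The length condition sits inside the existential so that [choice] gives one function on all
   words. *)
have lift_word s : exists u, size s = m -> [/\ u \in homog (m%:Z - i0),
    m%:Z = i0 -> u = 0 &
    contr1 f u = Z (basis_word e s) + zsign R i0 *: H (contr1 f (basis_word e s))].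
  have [sm|/eqP sm] := eqVneq (size s) m; last by exists 0.
  have hs := basis_word_homog e s; rewrite sm in hs.
  have [|u hu] := homotopy_lift hH H0 _ hs; last by exists u.
  by apply: Hm (homog_contr1 f hs); lia.
have [u hu] := choice lift_word.
(* This correction replaces [H] by [u] on words of length [m] and contributes nothing in other
   degrees. *)
pose v s := if size s == m then u s - H (basis_word e s) else 0.
pose H' : {linear ext E -> ext E} := H \+ coord_sum v.
have H'H k x : k != m%:Z -> x \in homog k -> H' x = H x.
  move=> km hx; rewrite /= (coord_sum_homog _ hx) big1 ?addr0 // => s /eqP sk.
  by rewrite /v; case: eqP => [sm|]; rewrite ?scaler0 //; rewrite -sk sm eqxx in km.
have H'm x : x \in homog m ->
    H' x = \sum_(s <- words | (size s)%:Z == m) coord d s x *: u s.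
  move=> hx; rewrite /= (coord_sum_homog _ hx) (homog_expand H hx) -big_split.
  by apply: eq_bigr => s /eqP[sm]; rewrite /= /v sm eqxx -scalerDr addrC subrK.
exists H'; split=> [k x hx|x hx|k x km hx].
- have [km|km] := eqVneq k m; last by rewrite (H'H _ _ km hx); apply: hH.
  rewrite km in hx *; rewrite (H'm _ hx); apply: rpred_sum => s /eqP[sm].
  by apply: rpredZ; case: (hu s sm).
- have [im|im] := eqVneq i0 m; last by rewrite (H'H _ _ im hx); apply: H0.
  rewrite im in hx; rewrite (H'm _ hx); apply: big1 => s /eqP[sm].
  by have [_ -> //] := hu s sm; rewrite scaler0.
(* [contr1 f x] has degree [k - 1], below [m], where [H] is unchanged. *)
have Hfx : H' (contr1 f x) = H (contr1 f x) by apply: H'H (homog_contr1 f hx); lia.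
rewrite /homotopy_at Hfx.
have [km'|km'] := eqVneq k m; last by rewrite (H'H _ _ km' hx); apply: Hm hx; lia.
rewrite km' in hx.
rewrite (H'm _ hx) linear_sum (homog_expand Z hx).
pose Hf : {linear ext E -> ext E} := H \o contr1 f.
rewrite -[H (contr1 f x)]/(Hf x) (homog_expand Hf hx) scaler_sumr -big_split.
apply: eq_bigr => s /eqP[sm]; have [_ _ fu] := hu s sm.
by rewrite linearZ /= fu scalerDr !scalerA mulrC.
Qed.

Lemma homotopy : exists H : {linear ext E -> ext E}, graded_op i0 H /\
  forall x, contr1 f (H x) - zsign R i0 *: H (contr1 f x) = Z x.
Proof.
(* Subwords of the [n] indices have length at most [n], so degrees below [n.+1] reach every basis
   word. *)
have [H [hH _ Hn]] := partial_homotopy n.+1.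
exists H; split=> // x; apply/eqP; rewrite subr_eq; apply/eqP.
pose H1 : {linear ext E -> ext E} := contr1 f \o H.
pose H2 : {linear ext E -> ext E} := Z \+ (zsign R i0 \*: (H \o contr1 f)).
rewrite -[LHS]/(H1 x) -[RHS]/(H2 x) (linear_coord_sum H1) (linear_coord_sum H2).
rewrite /coord_sum big_seq [RHS]big_seq; apply: eq_bigr => s /subwords_size.
rewrite size_enum_ord => sn; congr (_ *: _).
apply: Hn (basis_word_homog e s). by rewrite ltz_nat.
Qed.

End Homotopy.
End KoszulEndomorphisms.

(** * Surjectivity in cohomology *)

Section Surjectivity.
Variables (R : comPzRingType) (n : nat) (E : lmodType R) (e : 'I_n -> E).
Variable f : {linear E -> R^o}.

(** Cohomological degree [- j] is exterior degree [j], so a preimage under the differential has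
    exterior degree [j + 1]. *)
Lemma koszul_exact_op :
  (forall j : int, j != 0 -> cohomology_vanishes (koszul f) j) ->
  forall (j : int) (x : ext E), j != 0 -> x \in homog j -> contr1 f x = 0 ->
  exists2 y, y \in homog (j + 1) & x = contr1 f y.
Proof.
move=> f_exact j x j0 hx fx.
have hx' : x \in homog (- - j) by rewrite opprK.
pose X : koszul f (- j) := ExtPow hx'.
have cX : cocycle X by move=> k h; apply: val_inj.
have [|i [h [y Xy]]] := f_exact (- j) _ X cX; first by rewrite oppr_eq0.
have ij : j + 1 = - i by lia.
exists (extval y); first by rewrite ij; exact: extvalP.
exact: (congr1 (@extval _ _ _) Xy).
Qed.

Lemma contr_surjective_in_cohomology : is_basis e ->
  (forall j : int, j != 0 -> cohomology_vanishes (koszul f) j) ->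
  surjective_in_cohomology (contr_dga_hom f).
Proof.
move=> /dual_basis[d [de e_span]] /koszul_exact_op f_exact k y y_cocycle.
have [Y [hY yY]] := op_of_ghom de e_span y.
have [psi hpsi Ypsi] := op_contr de e_span hY.
(* The cocycle condition on [y], evaluated on homogeneous elements, says that [Y] graded-commutes
   with contraction by [f]. *)
have fY x : contr1 f (Y x) = zsign R k *: Y (contr1 f x).
  pose Y1 : {linear ext E -> ext E} := contr1 f \o Y.
  pose Y2 : {linear ext E -> ext E} := zsign R k \*: (Y \o contr1 f).
  apply: (ext_linear_homog de e_span (Y := Y1) (Z := Y2)) => j {}x hx.
  have hx' : x \in homog (- - j) by rewrite opprK.
  pose X : koszul f (- j) := ExtPow hx'.
  have e1 : - j + k + 1 = - j + (k + 1) by lia.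
  have e2 : - j + 1 + k = - j + (k + 1) by lia.
  have dy : ghom_d_fun (erefl (k + 1)) y = 0 := y_cocycle _ erefl.
  have := ghom_dE erefl y erefl erefl e1 erefl e2 X.
  rewrite dy => /(congr1 (@extval _ _ _)) /= /esym/eqP.
  by rewrite !yY subr_eq0 => /eqP.
pose Z : {linear ext E -> ext E} := Y \- contr psi.
have ZE x : Z x = Y x - contr psi x by [].
have hZ : graded_op k Z.
  by move=> j x hx; apply: rpredB; [apply: hY|apply: homog_contr].
have fZ x : contr1 f (Z x) = zsign R k *: Z (contr1 f x).
  by rewrite !ZE linearB /= fY (contr1_contr f x hpsi) -scalerBr.
have Z0 x : x \in homog k -> Z x = 0 by move=> hx; rewrite ZE Ypsi ?subrr.
have i0k : k - 1 + 1 = k by rewrite subrK.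
have [H [hH HZ]] := homotopy de e_span i0k hZ fZ Z0 f_exact.
(* [psi] is a cocycle because the differential on forms is zero; [H] then bounds the difference. *)
exists (ExtPow hpsi); first by move=> j h.
exists (k - 1), i0k, (ghom_of_op f hH).
apply: ghom_ext => p q h x.
have HZx := HZ (extval x); rewrite ZE -(yY _ _ h x) in HZx.
exact: esym HZx.
Qed.

End Surjectivity.

Theorem theorem2p2 (R : comPzRingType) (n : nat) (E : lmodType R) (e : 'I_n -> E)
    (e_basis : is_basis e) (f : {linear E -> R^o}) :
  exists i_ : dga_hom (ext_dga {linear E -> R^o}) (end_dga (koszul f)),
    (forall (k : int) (psi : extpow {linear E -> R^o} k)
            (p q : int) (h : p + k = q) (omega : koszul f p),
       extval (ghomf (i_ k psi) h omega) = contr (extval psi) (extval omega)) /\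
    ((forall j : int, j != 0 -> cohomology_vanishes (koszul f) j) ->
       surjective_in_cohomology i_ /\
       numerically_homotopy_abelian (dga_lie (end_dga (koszul f)))).
Proof.
exists (contr_dga_hom f); split=> // f_exact.
have i_surj := contr_surjective_in_cohomology e_basis f_exact.
by split=> //; apply: nha_of_surjective i_surj.
Qed.
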